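(* Let $\gamma,\alpha\in(0,1)$. Then $\mathrm{BMO}^+(\gamma)$ and $\mathrm{BMO}^+(\alpha)$ coincide. Moreover, for any $f\in L^1_{\mathrm{loc}}$, $\|f\|_{\mathrm{BMO}^+(\gamma)}\sim\|f\|_{\mathrm{BMO}^+(\alpha)}$, where the positive equivalence constants are independent of $f$.
   Context: Work in $\mathbb{R}^{n+1}$, with points $(x,t)$, $x\in\mathbb{R}^n$, $t\in\mathbb{R}$; $p\in(1,\infty)$ is fixed throughout. $Q(x,L)=\{y\in\mathbb{R}^n: x_i-\frac L2\le y_i<x_i+\frac L2 \text{ for all } i\in\{1,\dots,n\}\}$. A parabolic rectangle centered at $(x,t)$ with edge length $L\in(0,\infty)$ is $R=R(x,t,L)=Q(x,L)\times[t-L^p,t+L^p)$; $\mathcal{R}$ is the set of all parabolic rectangles. For $\gamma\in[0,1)$, $R^-(\gamma)=Q(x,L)\times[t-L^p,t-\gamma L^p)$ and $R^+(\gamma)=Q(x,L)\times[t+\gamma L^p,t+L^p)$. $f_A=\fint_A f=\frac1{|A|}\int_A f$, $f_+=\max\{f,0\}$. $L^1_{\mathrm{loc}}$ is the set of all locally integrable (real-valued) functions on $\mathbb{R}^{n+1}$. $F\sim G$ means that each is bounded by a positive constant times the other. $\mathrm{BMO}^+(\gamma)$ is the set of all $f\in L^1_{\mathrm{loc}}$ with $$\|f\|_{\mathrm{BMO}^+(\gamma)}=\sup_{R\in\mathcal{R}}\fint_{R^-(\gamma)}[f-f_{R^+(\gamma)}]_+<\infty.$$ *)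

(* Defs.v *)
From HB Require Import structures.
From mathcomp Require Import all_boot all_order all_algebra.
From mathcomp Require Import all_classical all_reals all_analysis.

Set Implicit Arguments.
Unset Strict Implicit.
Unset Printing Implicit Defensive.

Import Order.TTheory GRing.Theory Num.Theory.
Import numFieldNormedType.Exports.

Local Open Scope classical_set_scope.
Local Open Scope ring_scope.

Notation spacetime R n := ('rV[R]_n * R)%type.

(* Lebesgue measure on R^(n+1): the restriction of the Lebesgue outer measure
   to its Caratheodory-measurable sets, that is, to all Lebesgue-measurable
   sets and not only to the Borel ones. *)
Section lebesgue_outer_measure.
Variables (R : realType) (n : nat).
Implicit Types a b : spacetime R n.

Definition box a b : set (spacetime R n) :=
  [set z : spacetime R n |
    (forall i, a.1 ord0 i <= z.1 ord0 i < b.1 ord0 i) /\ a.2 <= z.2 < b.2].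

(* The truncations at 0 give volume 0 to a box with a <= b failing in some
   coordinate, which is empty. *)
Definition volume a b : R :=
  (\prod_(i < n) Num.max 0 (b.1 ord0 i - a.1 ord0 i)) * Num.max 0 (b.2 - a.2).

Definition box_cover (A : set (spacetime R n)) :=
  [set c : (spacetime R n * spacetime R n)^nat |
    A `<=` \bigcup_k box (c k).1 (c k).2].

Local Open Scope ereal_scope.

Definition lebesgue_outer (A : set (spacetime R n)) : \bar R :=
  ereal_inf [set \sum_(k <oo) (volume (c k).1 (c k).2)%:E | c in box_cover A].

Lemma volume_ge0 a b : (0 <= volume a b)%R.
Proof.
by apply: mulr_ge0; [apply: prodr_ge0 => i _|]; rewrite le_max lexx.
Qed.

Lemma lebesgue_outer_ge0 A : 0 <= lebesgue_outer A.
Proof.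
apply: le_ereal_inf_tmp => _ [c _ <-]; apply: nneseries_ge0 => k _ _.
by rewrite lee_fin volume_ge0.
Qed.

Lemma lebesgue_outer0 : lebesgue_outer set0 = 0.
Proof.
apply/eqP; rewrite eq_le lebesgue_outer_ge0 andbT.
apply: ereal_inf_lbound; exists (fun=> (point, point)); first exact: sub0set.
by rewrite eseries0// => k _ _; rewrite /volume /= subrr maxxx mulr0.
Qed.

Lemma le_lebesgue_outer : {homo lebesgue_outer : A B / A `<=` B >-> A <= B}.
Proof.
move=> A B AB; apply/ereal_inf_le_tmp => _ [c Bc <-].
by exists c => //; exact: subset_trans Bc.
Qed.

Lemma lebesgue_outer_sigma_subadditive : sigma_subadditive lebesgue_outer.
Proof.
move=> A; have [[i ioo]|] := pselect (exists i, lebesgue_outer (A i) = +oo).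
  rewrite (eseries_pinfty _ _ ioo) ?leey// => k _.
  by rewrite -ltNye (lt_le_trans _ (lebesgue_outer_ge0 _)).
rewrite -forallNE => Aoo.
suff add2e (e : {posnum R}) : lebesgue_outer (\bigcup_n A n) <=
    \sum_(i <oo) lebesgue_outer (A i) + e%:num%:E.
  by apply/lee_addgt0Pr => _/posnumP[].
rewrite (le_trans _ (epsilon_trick _ _ _))//; last first.
  by move=> k; exact: lebesgue_outer_ge0.
pose vol (c : spacetime R n * spacetime R n) := (volume c.1 c.2)%:E.
have vol_ge0 c : 0 <= vol c by rewrite lee_fin volume_ge0.
pose P k c := box_cover (A k) c /\
  \sum_(j <oo) vol (c j) <= lebesgue_outer (A k) + (e%:num / (2 ^ k.+1)%:R)%:E.
have [G PG] : {G : nat -> (spacetime R n * spacetime R n)^nat &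
    forall k, P k (G k)}.
  apply: (@choice _ _ P) => k; rewrite /P.
  have e1 : (0 < e%:num / (2 ^ k.+1)%:R :> R)%R by [].
  have fin : lebesgue_outer (A k) \is a fin_num.
    by rewrite ge0_fin_numE ?lebesgue_outer_ge0// ltey; exact/eqP/Aoo.
  have [_ [c Ac <-] cS] := lb_ereal_inf_adherent e1 fin.
  by exists c; split => //; exact/ltW.
have volG_ge0 x : 0 <= (vol \o uncurry G) x by exact: vol_ge0.
apply: (@le_trans _ _ (\esum_(i in setT) (vol \o uncurry G) i)).
  apply: ereal_inf_lbound => /=.
  have /card_esym/ppcard_eqP[f] := card_nat2.
  exists (uncurry G \o f).
    move=> t [i _ Ait]; have [j _ Bijt] := (PG i).1 _ Ait.
    by exists (f^-1%FUN (i, j)) => //=; rewrite invK ?inE.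
  rewrite -(esum_pred_image (vol \o uncurry G) _ xpredT) ?[fun=> _]set_true//.
  by rewrite image_eq.
rewrite (_ : esum _ _ = \sum_(i <oo) \sum_(j <oo) vol (G i j)); last first.
  pose J : nat -> set (nat * nat) := fun i => [set (i, j) | j in setT].
  rewrite (_ : setT = \bigcup_k J k); last first.
    by rewrite predeqE => -[a b]; split => // _; exists a => //; exists b.
  rewrite esum_bigcupT /=; last 2 first.
    - apply/trivIsetP => i j _ _ ij.
      rewrite predeqE => -[k m] /=; split => //= -[] [_] _ [<-{k} _].
      by move=> [m' _] [] /esym/eqP; rewrite (negbTE ij).
    - by move=> /= [k m]; exact: vol_ge0.
  rewrite -(image_id [set: nat]) -fun_true esum_pred_image//; last first.
    by move=> k _; exact: esum_ge0.
  apply: eq_eseriesr => /= j _.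
  rewrite -(esum_pred_image (vol \o uncurry G) (pair j) predT)//=; last first.
    by move=> ? ? _ _; exact: (@can_inj _ _ _ snd).
  by congr esum; rewrite predeqE => -[a b]; split; move=> [i _ <-]; exists i.
apply: lee_lim.
- apply: is_cvg_nneseries => k *.
  by apply: nneseries_ge0 => m *; exact: (volG_ge0 (k, m)).
- by apply: is_cvg_nneseries => k *; apply: adde_ge0 => //;
    exact: lebesgue_outer_ge0.
- by near=> k; apply: lee_sum => i _; exact: (PG i).2.
Unshelve. all: by end_near. Qed.

HB.instance Definition _ := isOuterMeasure.Build R (spacetime R n)
  lebesgue_outer lebesgue_outer0 lebesgue_outer_ge0 le_lebesgue_outer
  lebesgue_outer_sigma_subadditive.

End lebesgue_outer_measure.

Notation lebesgue_space R n := (caratheodory_type (@lebesgue_outer R n)).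

Section lebesgue_caratheodory.
Variables (R : realType) (n : nat).

Definition lebesgue : set (lebesgue_space R n) -> \bar R := @lebesgue_outer R n.

Let lebesgue0 : lebesgue set0 = 0%E.
Proof. exact: lebesgue_outer0. Qed.

Let lebesgue_ge0 A : (0 <= lebesgue A)%E.
Proof. exact: lebesgue_outer_ge0. Qed.

Let lebesgue_sigma_additive : semi_sigma_additive lebesgue.
Proof. by move=> F mF tF mUF; exact: caratheodory_measure_sigma_additive. Qed.

HB.instance Definition _ := isMeasure.Build _ _ _ lebesgue
  lebesgue0 lebesgue_ge0 lebesgue_sigma_additive.

End lebesgue_caratheodory.

Section parabolic_bmo.
Variables (R : realType) (n : nat) (p : R).
Implicit Types (x : 'rV[R]_n) (t L gamma : R) (f : spacetime R n -> R).

Local Notation mu := (@lebesgue R n).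

Definition L1loc f :=
  measurable_fun [set: lebesgue_space R n] f /\
  forall K : set (spacetime R n), compact K ->
    (\int[mu]_(z in K) `|f z|%:E < +oo)%E.

Definition avg f (A : set (spacetime R n)) : R :=
  (fine (mu A))^-1 * \int[mu]_(z in A) f z.

Definition cube x L : set 'rV[R]_n :=
  [set y : 'rV[R]_n |
    forall i, x ord0 i - L / 2 <= y ord0 i < x ord0 i + L / 2].

(* R^-(gamma) and R^+(gamma) for the parabolic rectangle R = R(x, t, L) *)
Definition lower_part gamma x t L : set (spacetime R n) :=
  cube x L `*` [set s | t - L `^ p <= s < t - gamma * L `^ p].

Definition upper_part gamma x t L : set (spacetime R n) :=
  cube x L `*` [set s | t + gamma * L `^ p <= s < t + L `^ p].

(* The outer average is that of a nonnegative function and is taken in the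
   extended reals, so that no infinite value is lost. *)
Definition bmo_norm gamma f : \bar R :=
  ereal_sup [set e | exists x t L, 0 < L /\
    e = ((mu (lower_part gamma x t L))^-1 *
         \int[mu]_(z in lower_part gamma x t L)
           (Num.max (f z - avg f (upper_part gamma x t L)) 0)%:E)%E].

Definition BMOplus gamma : set (spacetime R n -> R) :=
  [set f | L1loc f /\ (bmo_norm gamma f < +oo)%E].

End parabolic_bmo.

(* Main.v *)
(* Let M be the BMO^+(gamma) norm of f. Along a forward step, from a subset A of
   R^-(gamma) to the whole of R^+(gamma), the average of f decreases by at most
   M |R^-(gamma)| / |A|. The proof composes such steps, made with small
   rectangles, into passages from any small early piece of a unit parabolic
   rectangle R to the whole of R^+(alpha), with a cost bounded by a multiple of M.
   - In time: over a fixed cube, tiling the cube by small cubes gives steps of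
     arbitrarily short duration, hence a passage between any two intervals that
     are separated by a gap.
   - In space: split the unit cube into N^n cells. One step spreads a cell
     uniformly over a block of 2^n cells. Mass that stops as soon as it hits a
     prescribed neighbour reaches it after m steps, up to a fraction
     (1 - 2^-n)^m; so any cell is reached in m N steps, up to a fraction
     N (1 - 2^-n)^m. If that fraction is at most N^-n and the cell aimed at is the
     one where f has the least final average, then the bound obtained is at most
     the average over all cells. The elapsed time is of order m N^(1 - p) with
     m of order log N, which is as small as desired because p > 1.
   Finally, R^-(alpha) is covered by lower parts of small rectangles, and
   [f - f_{R^+(alpha)}]_+ <= [f - k]_+ + [k - f_{R^+(alpha)}]_+, where k is the
   average of f over the corresponding small upper part. *)

Require Import Defs.
From mathcomp Require Import all_boot all_order all_algebra.
From mathcomp Require Import all_classical all_reals all_analysis.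
From mathcomp Require Import measurable_realfun ring lra zify.

Set Implicit Arguments.
Unset Strict Implicit.
Unset Printing Implicit Defensive.

Import Order.TTheory GRing.Theory Num.Theory.
Import numFieldNormedType.Exports.

Local Open Scope classical_set_scope.
Local Open Scope ring_scope.

(** * Lebesgue measure of boxes *)

Section box_volume.
Variables (R : realType).
Implicit Types (a b : R).

Let lam := (@lebesgue_measure R).

Let chi a b (x : R) : R := (a <= x < b)%R%:R.

Let chiE a b : chi a b = \1_`[a, b[%classic.
Proof.
apply/funext => x; rewrite /chi indicE; congr (_%:R).
by rewrite mem_setE in_itv.
Qed.

Let integral_chi a b (c : R) : 0 <= c ->
  (\int[lam]_x (c * chi a b x)%:E = (c * Num.max 0 (b - a))%:E)%E.
Proof.
move=> c0; rewrite chiE; under eq_integral do rewrite EFinM.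
rewrite ge0_integralZl//=; last first.
  by apply/(@measurable_EFinP _ _ _ _ \1_`[a, b[)/measurable_indic.
rewrite integral_indic// setIT.
transitivity (c%:E * lam `[a, b[%classic)%E; first by [].
rewrite /lam lebesgue_measure_itv/= lte_fin.
have [ab|ab] := ltP a b.
  by rewrite EFinM (max_idPr _)// subr_ge0 ltW.
by rewrite (max_idPl _) ?subr_le0// mulr0 mule0.
Qed.

(** Monotone convergence allows the pointwise inequality to be integrated in [x] term by term. *)
Lemma cover_integral1 (c a b : R) (C A B : nat -> R) : 0 <= c ->
  (forall k, 0 <= C k) ->
  (forall x : R, ((c * (a <= x < b)%R%:R)%:E <=
     \sum_(k <oo) (C k * (A k <= x < B k)%R%:R)%:E)%E) ->
  ((c * Num.max 0 (b - a))%:E <=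
     \sum_(k <oo) (C k * Num.max 0 (B k - A k))%:E)%E.
Proof.
move=> c0 C0 H; rewrite -integral_chi//.
under eq_eseriesr do rewrite -integral_chi//.
have mchi d (u v : R) : measurable_fun [set: measurableTypeR R]
    (fun x => (d * chi u v x)%:E).
  apply/measurable_EFinP; rewrite chiE.
  by apply: measurable_funM => //; exact: measurable_indic.
have chi0 d u v x : 0 <= d -> (0 <= (d * chi u v x)%:E)%E.
  by move=> d0; rewrite lee_fin mulr_ge0.
rewrite -integral_nneseries//; last by move=> k x _; exact: chi0.
apply: ge0_le_integral => //.
- by move=> x _; exact: chi0.
- by apply: ge0_emeasurable_sum => // k x _ _; exact: chi0.
- by move=> x _; exact: H.
Qed.

(** Coordinates are integrated out one at a time: while one is integrated, the factors of the others
    sit in the weights, which is why the weights [c] and [C] are general. *)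
Lemma cover_prod n (c : R) (a b : 'I_n -> R) (C : nat -> R) (A B : nat -> 'I_n -> R) :
  0 <= c -> (forall k, 0 <= C k) ->
  (forall y : 'I_n -> R, ((c * \prod_(i < n) (a i <= y i < b i)%R%:R)%:E <=
     \sum_(k <oo) (C k * \prod_(i < n) (A k i <= y i < B k i)%R%:R)%:E)%E) ->
  ((c * \prod_(i < n) Num.max 0 (b i - a i))%:E <=
     \sum_(k <oo) (C k * \prod_(i < n) Num.max 0 (B k i - A k i))%:E)%E.
Proof.
elim: n c a b C A B => [|n IH] c a b C A B c0 C0 H.
  have := H (fun=> 0); rewrite !big_ord0 !mulr1 => H0.
  apply: (le_trans H0); apply: lee_nneseries => [k _ _|k _].
    by rewrite !big_ord0 lee_fin mulr1.
  by rewrite !big_ord0.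
rewrite big_ord_recl mulrA.
under eq_eseriesr do rewrite big_ord_recl mulrA.
have max0 (x : R) : 0 <= Num.max 0 x by rewrite le_max lexx.
apply: IH => [|k|y]; [exact: mulr_ge0|exact: mulr_ge0|].
rewrite mulrAC; under eq_eseriesr do rewrite mulrAC.
apply: cover_integral1.
- by rewrite mulr_ge0// prodr_ge0.
- by move=> k; rewrite mulr_ge0// prodr_ge0.
move=> x; have := H (fun i => if unlift ord0 i is Some j then y j else x).
rewrite big_ord_recl unlift_none mulrCA mulrC.
under eq_bigr do rewrite liftK.
move=> /le_trans; apply; rewrite le_eqVlt; apply/orP; left; apply/eqP.
apply: eq_eseriesr => k _; rewrite big_ord_recl unlift_none mulrCA [RHS]EFinM.
rewrite mulrC EFinM; congr (_%:E * _)%E.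
by under eq_bigr do rewrite liftK.
Qed.

Variable n : nat.
Implicit Types (u v : spacetime R n).


End box_volume.

Section lebesgue_box.
Variables (R : realType) (n : nat).
Implicit Types (a b z : spacetime R n).

Let mu := @lebesgue_outer R n.

Lemma indic_box a b z : \1_(box a b) z =
  (\prod_(i < n) (a.1 ord0 i <= z.1 ord0 i < b.1 ord0 i)%R%:R) *
  (a.2 <= z.2 < b.2)%R%:R :> R.
Proof.
rewrite indicE; have [/[!inE] -[H1 H2]|/negP zN] := boolP (z \in box a b).
  by rewrite H2 mulr1 big1// => i _; rewrite H1.
have [H2|] := boolP (a.2 <= z.2 < b.2)%R; last by rewrite mulr0.
have [i iN|H1] := pickP (fun i => ~~ (a.1 ord0 i <= z.1 ord0 i < b.1 ord0 i)%R).
  by rewrite (bigD1 i)//= (negbTE iN) !mul0r.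
by case: zN; rewrite inE; split=> // i; have := H1 i => /negbFE.
Qed.

Lemma lebesgue_outer_box a b : mu (box a b) = (volume a b)%:E.
Proof.
apply/eqP; rewrite eq_le; apply/andP; split.
  (* The cover is padded with boxes [(a, a)], degenerate in time and hence of volume 0 even for
     [n = 0]. *)
  apply: ereal_inf_lbound; exists (fun k => if k is 0%N then (a, b) else (a, a)).
    by move=> z abz; exists 0%N.
  rewrite (@nneseries_split _ _ 0 1)// => [|k _]; last by rewrite lee_fin volume_ge0.
  rewrite add0n big_nat1 eseries0 ?adde0// => -[|k]// _ _.
  by rewrite /volume subrr maxxx mulr0.
(* A cover dominates the indicator of the box pointwise; integrating in time and then in each space
   coordinate gives the lower bound. *)
apply: le_ereal_inf_tmp => _ [c cov <-].
have max0 (x : R) : 0 <= Num.max 0 x by rewrite le_max lexx.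
rewrite /volume mulrC; under eq_eseriesr do rewrite mulrC.
apply: cover_prod => // y; rewrite mulrC; under eq_eseriesr do rewrite mulrC.
apply: cover_integral1 => [|k|s]; [exact: prodr_ge0|exact: prodr_ge0|].
pose z : spacetime R n := (\row_i y i, s).
have boxE u v : \1_(box u v) z = (\prod_(i < n) (u.1 ord0 i <= y i < v.1 ord0 i)%R%:R) *
  (u.2 <= s < v.2)%R%:R :> R.
  by rewrite indic_box; congr (_ * _); apply: eq_bigr => i _; rewrite mxE.
rewrite -boxE; under eq_eseriesr do rewrite -boxE.
have pos k : (0%N <= k)%N -> xpredT k -> (0 <= (\1_(box (c k).1 (c k).2) z : R)%:E)%E.
  by move=> _ _; rewrite lee_fin indicE.
rewrite [leLHS](_ : _ = (z \in box a b)%:R%:E)//.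
have [/[!inE] /cov[k _ ck]|_] := boolP (z \in box a b); last exact: nneseries_ge0.
apply: le_trans (nneseries_lim_ge k.+1 pos).
rewrite big_nat_recr//= [X in (_ + X)%E](_ : _ = 1%E); last first.
  by rewrite indicE mem_set.
by rewrite leeDr// sume_ge0// => i _; exact: pos.
Qed.

(** Each box of a cover is cut into a piece for [A] and a piece for its complement without changing
    the total volume, so the sums of a cover split. This serves for half-spaces, from which boxes
    are built. *)
Lemma caratheodory_box_split (A : set (spacetime R n))
    (s1 s2 : spacetime R n * spacetime R n -> spacetime R n * spacetime R n) :
  (forall c, box c.1 c.2 `&` A `<=` box (s1 c).1 (s1 c).2) ->
  (forall c, box c.1 c.2 `&` ~` A `<=` box (s2 c).1 (s2 c).2) ->
  (forall c, volume (s1 c).1 (s1 c).2 + volume (s2 c).1 (s2 c).2 = volume c.1 c.2) ->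
  mu.-caratheodory A.
Proof.
move=> h1 h2 vol; apply: le_caratheodory_measurable => X.
apply: le_ereal_inf_tmp => _ [c cov <-].
rewrite (eq_eseriesr (g := fun k => ((volume (s1 (c k)).1 (s1 (c k)).2)%:E
   + (volume (s2 (c k)).1 (s2 (c k)).2)%:E)%E)); last first.
  by move=> k _; rewrite -EFinD vol.
rewrite nneseriesD; [|by move=> k _ _; rewrite lee_fin volume_ge0..].
apply: leeD; apply: ereal_inf_lbound.
  exists (s1 \o c) => // z [/cov[k _ ck] Az]; exists k => //; exact: h1.
exists (s2 \o c) => // z [/cov[k _ ck] Az]; exists k => //; exact: h2.
Qed.

Lemma max_split (x y c : R) : Num.max 0 (Num.min y c - x) + Num.max 0 (y - Num.max x c) =
  Num.max 0 (y - x).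
Proof.
rewrite !maxEle !minEle; do !case: ifPn => //; rewrite -?ltNge => *; lra.
Qed.

Lemma caratheodory_time (c : R) : mu.-caratheodory [set z : spacetime R n | z.2 < c].
Proof.
apply: (@caratheodory_box_split _
  (fun k => (k.1, (k.2.1, Num.min k.2.2 c))) (fun k => ((k.1.1, Num.max k.1.2 c), k.2))).
- move=> k z [[H1 /andP[H2 H3]] /= zc]; split=> //=.
  by rewrite H2 lt_min H3.
- move=> k z [[H1 /andP[H2 H3]] /= /negP]; rewrite -leNgt => zc; split=> //=.
  by rewrite H3 ge_max H2 zc.
- by move=> k; rewrite /volume /= -mulrDr max_split.
Qed.

Lemma caratheodory_space (j : 'I_n) (c : R) :
  mu.-caratheodory [set z : spacetime R n | z.1 ord0 j < c].
Proof.
pose cut (f : R -> R -> R) (v : 'rV[R]_n) : 'rV[R]_n :=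
  \row_i (if i == j then f (v ord0 i) c else v ord0 i).
apply: (@caratheodory_box_split _
  (fun k => (k.1, (cut Num.min k.2.1, k.2.2)))
  (fun k => ((cut Num.max k.1.1, k.1.2), k.2))).
- move=> k z [[H1 H2] /= zc]; split=> //= i; rewrite mxE.
  have /andP[H3 H4] := H1 i; rewrite H3/=.
  by case: eqP => [->|//]; have /andP[_ h] := H1 j; rewrite lt_min h zc.
- move=> k z [[H1 H2] /= /negP]; rewrite -leNgt => zc; split=> //= i; rewrite mxE.
  have /andP[H3 H4] := H1 i; rewrite H4 andbT.
  by case: eqP => [->|//]; have /andP[h _] := H1 j; rewrite ge_max h zc.
- move=> k; rewrite /volume /= -mulrDl; congr (_ * _).
  rewrite (bigD1 j)//= [X in _ + X](bigD1 j)//= [RHS](bigD1 j)//= !mxE eqxx.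
  rewrite -[in RHS](max_split _ _ c) mulrDl; congr (_ * _ + _ * _).
    by apply: eq_bigr => i /negbTE ij; rewrite mxE ij.
  by apply: eq_bigr => i /negbTE ij; rewrite mxE ij.
Qed.

Lemma measurable_box a b : measurable (box a b : set (lebesgue_space R n)).
Proof.
have -> : box a b =
    ([set z : spacetime R n | z.2 < b.2] `&` ~` [set z : spacetime R n | z.2 < a.2]) `&`
    \bigcap_(i in [set: 'I_n]) ([set z : spacetime R n | z.1 ord0 i < b.1 ord0 i] `&`
                   ~` [set z : spacetime R n | z.1 ord0 i < a.1 ord0 i]).
  apply/seteqP; split => [z [H1 /andP[H2 H3]]|z [[H1 /negP H2] H3]].
    split; first by split => //; apply/negP; rewrite -leNgt.
    move=> i _; have /andP[h1 h2] := H1 i; split => //=.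
    by apply/negP; rewrite -leNgt.
  split=> [i|]; last by rewrite leNgt H2.
  have [h1 /negP h2] := H3 i Logic.I.
  by rewrite leNgt h2.
apply: (@measurableI _ (lebesgue_space R n)).
  apply: (@measurableI _ (lebesgue_space R n)); first exact: caratheodory_time.
  by apply: (@measurableC _ (lebesgue_space R n)); exact: caratheodory_time.
apply: (@fin_bigcap_measurable _ (lebesgue_space R n)) => // i _.
apply: (@measurableI _ (lebesgue_space R n)); first exact: caratheodory_space.
by apply: (@measurableC _ (lebesgue_space R n)); exact: caratheodory_space.
Qed.

(** A countable intersection of half-open boxes. Closed boxes, being compact, give access to local
    integrability. *)
Lemma measurable_closed_box a b : measurable ([set z : spacetime R n |
  (forall i, a.1 ord0 i <= z.1 ord0 i <= b.1 ord0 i) /\ a.2 <= z.2 <= b.2]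
  : set (lebesgue_space R n)).
Proof.
pose up (k : nat) : spacetime R n :=
  (\row_i (b.1 ord0 i + k.+1%:R^-1), b.2 + k.+1%:R^-1).
rewrite [X in measurable X](_ : _ = \bigcap_k (box a (up k))).
  by apply: bigcapT_measurable => k; exact: measurable_box.
have gt (x : R) k : x < x + k.+1%:R^-1 by rewrite ltrDl invr_gt0 ltr0n.
have le (x y : R) : (forall k, x < y + k.+1%:R^-1) -> x <= y.
  move=> H; apply/ler_addgt0Pr => e e0.
  apply: le_trans (ltW (H (Num.truncn e^-1))) _; rewrite lerD2l.
  rewrite -[leRHS]invrK lef_pV2 ?posrE ?invr_gt0//.
  exact/ltW/truncnS_gt.
apply/seteqP; split => [z [H1 /andP[H2 H3]] k _|z H].
  split=> [i|]; last by rewrite H2 /=; exact: le_lt_trans H3 (gt _ _).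
  have /andP[h1 h2] := H1 i; rewrite h1 mxE /=; exact: le_lt_trans h2 (gt _ _).
split=> [i|].
  apply/andP; split; first by have [/(_ i) /andP[]] := H 0%N Logic.I.
  by apply: le => k; have [/(_ i) /andP[_]] := H k Logic.I; rewrite mxE.
apply/andP; split; first by have [_ /andP[]] := H 0%N Logic.I.
by apply: le => k; have [_ /andP[]] := H k Logic.I.
Qed.

End lebesgue_box.

(** * Transport in time *)

Lemma pos_neq0 (R : realType) (x : R) : 0 < x -> x != 0.
Proof. exact: lt0r_neq0. Qed.

Ltac nz := repeat (apply/andP; split);
  match goal with |- is_true (negb (eq_op ?x _)) =>
    let H := fresh in assert (H : 0 < x) by lra; exact (pos_neq0 H) end.

Section interval_functions.
Variables (R : realType) (g : R -> R -> R) (M : R).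
Implicit Types a b c d x y h tau kappa delta : R.

Definition interval_additive :=
  forall a b c : R, a <= b -> b <= c -> g a c = g a b + g b c.

(** A window of length [h] is shifted by [tau]. The error is that of a full window however short the
    piece [[a', b')] is, so pieces and steps have to be counted. *)
Definition forward_step h tau := forall a a' b' : R, a <= a' -> a' <= b' ->
  b' <= a + h -> g a' b' <= (b' - a') / h * g (a + tau) (a + tau + h) + M * h.

Hypotheses (M0 : 0 <= M) (gD : interval_additive).

Lemma forward_iter h tau (k : nat) x : 0 < h -> forward_step h tau ->
  g x (x + h) <= g (x + k%:R * tau) (x + k%:R * tau + h) + k%:R * (M * h).
Proof.
move: M0 => M1 h_gt0 st; elim: k => [|k IH]; first by rewrite !mul0r !addr0.
apply: (le_trans IH).
have xh : x + k%:R * tau <= x + k%:R * tau + h by lra.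
have := st _ _ _ (lexx (x + k%:R * tau)) xh (lexx _).
rewrite (_ : (x + k%:R * tau + h - (x + k%:R * tau)) / h = 1); last by field; nz.
rewrite mul1r (_ : x + k.+1%:R * tau = x + k%:R * tau + tau); last by ring.
by rewrite (_ : k.+1%:R * (M * h) = k%:R * (M * h) + M * h); [lra|ring].
Qed.

Variables h0 tau0 h1 tau1 Delta : R.
Hypotheses (h0_gt0 : 0 < h0) (tau0_gt0 : 0 < tau0) (h1_gt0 : 0 < h1).
Hypotheses (small : h0 + tau0 <= h1).
Hypotheses (st0 : forward_step h0 tau0) (st1 : forward_step h1 tau1).

(** Costs, in units of [M], of at most [Delta / tau0] short steps, of the long step and of the
    initial short step. *)
Let C1 := Delta / tau0 * h0 + h1 + h0.

(* Short steps bring a short piece inside the unique window of length [h1] that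
   one long step maps onto [y, y + h1). *)
Lemma short_interval_forward a b y : a <= b -> b <= a + h0 ->
  a + tau0 + tau1 <= y -> y - a <= tau1 + Delta ->
  g a b <= (b - a) / h1 * g y (y + h1) + C1 * M.
Proof.
move: h0_gt0 tau0_gt0 h1_gt0 small M0 => P0 Q0 P1 sm M1.
move=> ab bh ay yD; set x := a + tau0; pose u : R := (y - tau1 - x) / tau0.
have u0 : 0 <= u by apply: divr_ge0; [rewrite /x; lra|exact: ltW].
have [k ku ku'] : exists2 k : nat, u < k%:R & k%:R <= u + 1.
  exists (Num.truncn u).+1; first exact: truncnS_gt.
  by rewrite -natr1 lerD2r truncn_le ?nnegrE.
have uE : u * tau0 = y - tau1 - x by rewrite /u; field; nz.
(* After [k] further short steps the window overshoots [y - tau1] by at most [tau0]; by [small] it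
   lies inside [[y - tau1, y - tau1 + h1)], ready for the long step. *)
have kt : y - tau1 <= x + k%:R * tau0.
  by move: ku; rewrite -(ltr_pM2r tau0_gt0) uE; lra.
have kt' : x + k%:R * tau0 <= y - tau1 + tau0.
  by move: ku'; rewrite -(ler_pM2r tau0_gt0) mulrDl uE; lra.
have kD : k%:R * tau0 <= Delta by move: kt'; rewrite /x; lra.
have kD' : k%:R * h0 <= Delta / tau0 * h0.
  by rewrite ler_pM2r// ler_pdivlMr.
have s1 := st0 (lexx a) ab bh.
have s2 := @forward_iter h0 tau0 k x h0_gt0 st0.
have s3 := st1 kt (ltac:(lra) : x + k%:R * tau0 <= x + k%:R * tau0 + h0)
  (ltac:(lra) : x + k%:R * tau0 + h0 <= y - tau1 + h1).
move: s3; rewrite (_ : y - tau1 + tau1 = y); last by ring.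
rewrite (_ : (x + k%:R * tau0 + h0 - (x + k%:R * tau0)) = h0); last by ring.
move=> s3; have {}s2 := le_trans s2 (lerD s3 (lexx _)).
rewrite -/x in s1.
have th : 0 <= (b - a) / h0 by apply: divr_ge0; lra.
have th1 : (b - a) / h0 <= 1 by rewrite ler_pdivrMr//; lra.
have := le_trans s1 (lerD (ler_wpM2l th s2) (lexx _)).
rewrite (_ : (b - a) / h0 * (h0 / h1 * g y (y + h1) + M * h1 + k%:R * (M * h0)) + M * h0
   = (b - a) / h1 * g y (y + h1) + (b - a) / h0 * (M * (h1 + k%:R * h0)) + M * h0); last by field; nz.
move/le_trans; apply; rewrite -addrA lerD2l.
have P : 0 <= M * (h1 + k%:R * h0) by rewrite mulr_ge0// addr_ge0 ?mulr_ge0// ltW.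
apply: (@le_trans _ _ (M * (h1 + k%:R * h0) + M * h0)).
  by rewrite lerD2r ler_piMl.
by rewrite /C1; nra.
Qed.

(** [[a, b)] is cut into at most [r] pieces of length at most [h0], all sent to the same window;
    masses and costs add. *)
Lemma interval_forward (r : nat) a b y : 0 <= Delta -> a <= b -> b <= a + r%:R * h0 ->
  b + tau0 + tau1 <= y -> y - a <= tau1 + Delta ->
  g a b <= (b - a) / h1 * g y (y + h1) + r%:R * (C1 * M).
Proof.
move: h0_gt0 tau0_gt0 h1_gt0 small M0 => P0 Q0 P1 sm M1.
move=> D0; have C10 : 0 <= C1 * M.
  by rewrite mulr_ge0// /C1 !addr_ge0 ?mulr_ge0 ?invr_ge0// ltW.
elim: r a => [|r IH] a ab bh ay yD.
  have -> : b = a by lra.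
  by rewrite subrr !mul0r addr0; have := gD (lexx a) (lexx a); lra.
have [bh0|bh0] := leP b (a + h0).
  have h := @short_interval_forward a b y ab bh0 (ltac:(lra)) yD.
  apply: (le_trans h); rewrite lerD2l ler_peMl// -natr1 lerDr.
  exact: ler0n.
rewrite (gD (_ : a <= a + h0) (ltW bh0)); last lra.
have := @short_interval_forward a (a + h0) y (ltac:(lra)) (lexx _) (ltac:(lra)) yD.
have := IH (a + h0) (ltW bh0) (ltac:(move: bh; rewrite -natr1; lra)) ay (ltac:(lra)).
rewrite -natr1; have -> : (b - a) / h1 = (b - (a + h0)) / h1 + (a + h0 - a) / h1 by field; nz.
by lra.
Qed.

Lemma windows_lower_bound kappa c (k : nat) :
  (forall y : R, c <= y -> y + h1 <= c + k%:R * h1 -> h1 * kappa <= g y (y + h1)) ->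
  k%:R * h1 * kappa <= g c (c + k%:R * h1).
Proof.
move: h0_gt0 tau0_gt0 h1_gt0 small M0 => P0 Q0 P1 sm M1.
elim: k => [|k IH] H.
  by rewrite !mul0r addr0; have := gD (lexx c) (lexx c); lra.
have hk : 0 <= k%:R * h1 by rewrite mulr_ge0// ltW.
have e : c + k.+1%:R * h1 = c + k%:R * h1 + h1 by ring.
rewrite e in H *.
rewrite (@gD c (c + k%:R * h1)) ?lerDl//; [|lra].
have := H (c + k%:R * h1) (ltac:(lra)) (lexx _).
have := IH (fun y cy yk => H y cy (ltac:(lra))).
by rewrite -natr1; lra.
Qed.

(* Windows of length [h1] cannot tile [c, d) exactly: the overlap of the first
   two is a source, whose mass is moved into the last window. *)
Lemma interval_lower_bound (r : nat) kappa c d : 0 <= Delta -> 0 <= tau1 ->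
  h1 <= r%:R * h0 -> d - c <= Delta ->
  2 * h1 + tau0 + tau1 <= d - c ->
  (forall y : R, c <= y -> y + h1 <= d -> h1 * kappa <= g y (y + h1)) ->
  (d - c) * kappa <= g c d + r%:R * (C1 * M).
Proof.
move: h0_gt0 tau0_gt0 h1_gt0 small M0 => P0 Q0 P1 sm M1.
move=> D0 t10 rh dD dc H.
have C10 : 0 <= C1 * M.
  by rewrite mulr_ge0// /C1 !addr_ge0 ?mulr_ge0 ?invr_ge0// ltW.
pose u : R := (d - c) / h1; have uE : u * h1 = d - c by rewrite /u; field; nz.
have u1 : 1 <= u by rewrite /u ler_pdivlMr//; lra.
(* One full window is set aside for the end: [k] windows tile [[c + rho, d - h1)] and the last one
   is [[d - h1, d)]. *)
pose k := (Num.truncn u).-1.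
have kE : k.+1 = Num.truncn u by rewrite /k prednK// truncn_gt0.
have ku : k.+1%:R <= u by rewrite kE truncn_le ?nnegrE//; lra.
have ku' : u < k.+1%:R + 1 by rewrite kE natr1; exact: truncnS_gt.
move: ku ku'; rewrite -natr1 => ku ku'.
set rho := d - c - (k%:R + 1) * h1.
have r0 : 0 <= rho by rewrite /rho; nra.
have r1 : rho <= h1 by rewrite /rho; nra.
have k0 : 0 <= k%:R * h1 by rewrite mulr_ge0// ltW.
have dE : d - h1 = c + rho + k%:R * h1 by rewrite /rho; ring.
have e1 := gD (ltac:(lra) : c <= c + rho) (ltac:(lra) : c + rho <= d).
have e2 := gD (ltac:(lra) : c <= c + rho) (ltac:(lra) : c + rho <= c + h1).
have e3 := gD (ltac:(lra) : c + rho <= d - h1) (ltac:(lra) : d - h1 <= d).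
have s := @interval_forward r (c + rho) (c + h1) (d - h1) D0 (ltac:(lra)) (ltac:(lra))
  (ltac:(lra)) (ltac:(lra)).
have w := @windows_lower_bound kappa (c + rho) k (fun y cy yk => H y (ltac:(lra)) (ltac:(lra))).
rewrite -dE in w.
have H1 := H c (lexx c) (ltac:(lra)).
have H2 := H (d - h1) (ltac:(lra)) (ltac:(lra)).
rewrite (_ : d - h1 + h1 = d) in H2 s; last by ring.
set G := g (d - h1) d in s H2 e3 *.
(* The overlap [[c + rho, c + h1)] is charged to a fraction at most 1 of the mass [G] of the last
   window; the lower bound on [G] applies to the rest. *)
have t0 : 0 <= 1 - (c + h1 - (c + rho)) / h1.
  rewrite subr_ge0 ler_pdivrMr//; lra.
have H3 := ler_wpM2l t0 H2.
move: s H3; set q := (c + h1 - (c + rho)) / h1 => s H3.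
have qE : q * h1 = h1 - rho by rewrite /q; field; nz.
have : (d - c) * kappa = h1 * kappa + k%:R * h1 * kappa + (h1 - q * h1) * kappa.
  by rewrite qE /rho; ring.
by move: H3; lra.
Qed.

(** The source is compared with every window of [[c, d)], then the windows with the whole of
    [[c, d)]; each comparison costs [r%:R * C1 / delta * M], hence the factor 2. *)
Lemma interval_transport (r : nat) a b c d delta : 0 <= Delta -> 0 <= tau1 ->
  0 < delta -> delta <= b - a -> delta <= d - c -> d - a <= Delta ->
  h1 <= r%:R * h0 -> b - a <= r%:R * h0 ->
  2 * h1 + tau0 + tau1 <= delta -> b + tau0 + tau1 <= c ->
  g a b / (b - a) <= g c d / (d - c) + (2 * r%:R * C1 / delta) * M.
Proof.
move: h0_gt0 tau0_gt0 h1_gt0 small M0 => P0 Q0 P1 sm M1.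
move=> D0 t10 de0 ba dc da rh rba hde bc.
set kappa := g a b / (b - a) - r%:R * C1 / delta * M.
have rC : 0 <= r%:R * C1 * M.
  by rewrite !mulr_ge0// /C1 !addr_ge0 ?mulr_ge0 ?invr_ge0// ltW.
have H y : c <= y -> y + h1 <= d -> h1 * kappa <= g y (y + h1).
  move=> cy yd.
  have := @interval_forward r a b y D0 (ltac:(lra)) (ltac:(lra)) (ltac:(lra)) (ltac:(lra)).
  move=> s; have ba0 : 0 < (b - a)^-1 by rewrite invr_gt0; lra.
  have := ler_wpM2r (ltW ba0) s.
  rewrite mulrDl (_ : (b - a) / h1 * g y (y + h1) / (b - a) = g y (y + h1) / h1); last by field; nz.
  move=> s'.
  have : r%:R * (C1 * M) / (b - a) <= r%:R * C1 / delta * M.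
    rewrite mulrA (_ : _ / delta * M = r%:R * C1 * M / delta); last by field; nz.
    by rewrite ler_wpM2l// lef_pV2 ?posrE; lra.
  move=> s2; have : kappa <= g y (y + h1) / h1 by rewrite /kappa; lra.
  by rewrite ler_pdivlMr// mulrC.
have := @interval_lower_bound r kappa c d D0 t10 rh (ltac:(lra)) (ltac:(lra)) H.
move=> s; have dc0 : 0 < (d - c)^-1 by rewrite invr_gt0; lra.
have := ler_wpM2r (ltW dc0) s.
rewrite mulrAC divff; last by nz.
rewrite mul1r mulrDl => s'.
have : r%:R * (C1 * M) / (d - c) <= r%:R * C1 / delta * M.
  rewrite mulrA (_ : _ / delta * M = r%:R * C1 * M / delta); last by field; nz.
  by rewrite ler_wpM2l// lef_pV2 ?posrE; lra.
rewrite (_ : 2 * r%:R * C1 / delta * M = r%:R * C1 / delta * M + r%:R * C1 / delta * M); last by field; nz.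
by move: s'; rewrite /kappa; lra.
Qed.

End interval_functions.

(** * Transport in space *)

Section mixing.
Variables (R : realType) (n N m : nat) (U : nat -> ('I_n -> nat) -> R).
Implicit Types (v z : 'I_n -> nat).

Let inr v := forall i, (v i < N)%N.
(** The fraction of a uniformly spread block that misses one prescribed cell. *)
Let r : R := 1 - (2 ^ n)%:R^-1.

Hypothesis hold : forall k v, inr v -> U k v <= U k.+1 v.
Hypothesis block : forall k z (j : {ffun 'I_n -> 'I_2}),
  (forall i, ((z i).+1 < N)%N) -> U k (fun i => z i + j i)%N <=
  (2 ^ n)%:R^-1 * \sum_(l : {ffun 'I_n -> 'I_2}) U k.+1 (fun i => z i + l i)%N.

Let r_ge0 : 0 <= r.
Proof.
rewrite /r subr_ge0 invf_le1 ?ltr0n ?expn_gt0//.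
by rewrite ler1n expn_gt0.
Qed.

(** Mass stops on hitting the target [z + l], where it is worth at most [y]; the fraction [r ^+ s]
    still moving after [s] steps is worth at most [Y]. *)
Lemma block_absorb t z (l : {ffun 'I_n -> 'I_2}) (y Y : R) :
  (forall i, ((z i).+1 < N)%N) ->
  (forall k, (k <= t)%N -> U k (fun i => z i + l i)%N <= y) ->
  (forall j : {ffun 'I_n -> 'I_2}, U t (fun i => z i + j i)%N <= Y) ->
  forall s, (s <= t)%N -> forall j : {ffun 'I_n -> 'I_2},
  U (t - s)%N (fun i => z i + j i)%N <= y + r ^+ s * (Y - y).
Proof.
move=> zN Hy HY; elim=> [|s IH] st j.
  by rewrite subn0 expr0 mul1r; have := HY j; lra.
apply: (le_trans (@block _ z j zN)).
have -> : (t - s.+1).+1 = (t - s)%N by lia.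
set a : R := _^-1; have a0 : 0 <= a by rewrite invr_ge0.
have aE : a * (2 ^ n)%:R = 1 by rewrite mulVf// pnatr_eq0 expn_eq0.
rewrite (bigD1 l)//= mulrDr.
have H1 : a * U (t - s)%N (fun i => z i + l i)%N <= a * y.
  by apply: ler_wpM2l => //; apply: Hy; lia.
set x := y + r ^+ s * (Y - y).
have H2 : \sum_(i : {ffun 'I_n -> 'I_2} | i != l)
    U (t - s)%N (fun j0 => z j0 + i j0)%N <= ((2 ^ n)%:R - 1) * x.
  apply: (@le_trans _ _ (\sum_(i : {ffun 'I_n -> 'I_2} | i != l) x)).
    by apply: ler_sum => i _; apply: IH; exact: ltnW.
  rewrite sumr_const -[X in x *+ X]/#|predC1 l| cardC1 card_ffun !card_ord.
  by rewrite -[x *+ _]mulr_natl -subn1 natrB // expn_gt0.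
have H3 := ler_wpM2l a0 H2.
rewrite mulrA mulrBr aE mulr1 in H3.
have -> : y + r ^+ s.+1 * (Y - y) = a * y + (1 - a) * x.
  by rewrite exprS /x -/(1 - a); rewrite /r -/a; ring.
by lra.
Qed.

Let step v (c : 'I_n -> nat) i :=
  if (v i < c i)%N then (v i).+1 else if (c i < v i)%N then (v i).-1 else v i.

(** Induction on the distance [d] to [c] in the maximum norm: a move to a neighbour closer to [c]
    takes [m] steps and loses the fraction [r ^+ m]; the losses add up. *)
Lemma spread (c : 'I_n -> nat) (y Y : R) : (1 < N)%N -> inr c -> y <= Y ->
  U (m * N)%N c <= y -> (forall v, inr v -> U (m * N)%N v <= Y) ->
  forall d, (d <= N)%N -> forall v, inr v ->
  (forall i, (v i <= c i + d)%N /\ (c i <= v i + d)%N) ->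
  U (m * (N - d))%N v <= y + d%:R * r ^+ m * (Y - y).
Proof.
move=> N1 cN yY Hc HY.
have holds v k k' : inr v -> (k <= k')%N -> U k v <= U k' v.
  move=> vN /subnK <-; elim: (k' - k)%N => [|q IH]//.
  by rewrite addSn; exact: le_trans IH (hold _ _).
elim=> [|d IH] dN v vN dist.
  rewrite subn0 !mul0r addr0 (_ : v = c)//.
  by apply/funext => i; have := dist i; lia.
(* [z] is the lower corner of a block containing both [v] and its neighbour [v'], capped at [N - 2]
   so that the block stays in the grid. *)
pose v' := step v c; pose z i := minn (minn (v i) (v' i)) (N - 2).
have vi i : (v' i = v i + (v i < c i) - (c i < v i))%N.
  by rewrite /v' /step; case: ltngtP => _ /=; lia.
have zN i : ((z i).+1 < N)%N by rewrite /z; lia.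
have v'N : inr v'.
  by move=> i; rewrite vi; have := vN i; have := cN i; case: ltngtP => /=; lia.
have zv i : (z i <= v i <= z i + 1)%N.
  by rewrite /z vi; have := vN i; have := cN i; case: ltngtP => /=; lia.
have zv' i : (z i <= v' i <= z i + 1)%N.
  by rewrite /z vi; have := vN i; have := cN i; case: ltngtP => /=; lia.
have lP w : (forall i, z i <= w i <= z i + 1)%N ->
    exists l : {ffun 'I_n -> 'I_2}, w = (fun i => z i + l i)%N.
  move=> H; exists [ffun i => inord (w i - z i)].
  by apply/funext => i; rewrite ffunE inordK; have := H i; lia.
have [l v'E] := lP _ zv'; have [j vE] := lP _ zv.
set y' := y + d%:R * r ^+ m * (Y - y).
have mE : (m * (N - d.+1) = m * (N - d) - m)%N.
  by rewrite subnS -subn1 mulnBr muln1.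
rewrite mE vE.
apply: (@le_trans _ _ (y' + r ^+ m * (Y - y'))).
  apply: (@block_absorb _ z l y' Y zN).
  - move=> k km; rewrite -v'E; apply: le_trans (holds _ _ _ v'N km) _.
    apply: IH => //; first exact: ltnW.
    by move=> i; rewrite vi; have := dist i; case: ltngtP => /=; lia.
  - move=> i; apply: le_trans (HY _ _).
      by apply: holds; [move=> q; have := ltn_ord (i q); have := zN q; lia|rewrite leq_mul2l; lia].
    by move=> q; have := ltn_ord (i q); have := zN q; lia.
  - by apply: leq_pmulr; lia.
have rm : 0 <= r ^+ m by exact: exprn_ge0.
(* The term quadratic in [r ^+ m] has a favourable sign and is dropped. *)
have rmY : 0 <= r ^+ m * (d%:R * r ^+ m * (Y - y)).
  by rewrite !mulr_ge0// subr_ge0.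
rewrite /y' -natr1; move: (r ^+ m) rm rmY => x x0 xY.
have -> : y + d%:R * x * (Y - y) + x * (Y - (y + d%:R * x * (Y - y))) =
  y + (d%:R + 1) * x * (Y - y) - x * (d%:R * x * (Y - y)) by ring.
by lra.
Qed.

(** The target is the cell of least final value. Multiplied by [N ^ n], the lost fraction
    [N%:R * r ^+ m] is at most 1, so the excess of the largest final value over the least pays for
    the loss. *)
Lemma mixing v : (1 < N)%N -> inr v -> (N ^ n.+1)%:R * r ^+ m <= 1 ->
  (N ^ n)%:R * U 0%N v <= \sum_(w : {ffun 'I_n -> 'I_N}) U (m * N)%N (fun i => w i).
Proof.
move=> N1 vN small.
pose f (w : {ffun 'I_n -> 'I_N}) := U (m * N)%N (fun i => w i).
pose w0 : {ffun 'I_n -> 'I_N} := [ffun i => Ordinal (vN i)].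
have [c _ cmin] := @arg_minP _ _ _ w0 xpredT f isT.
have [C _ cmax] := @arg_maxP _ _ _ w0 xpredT f isT.
have cC : f c <= f C by exact: cmin.
have HY u : inr u -> U (m * N)%N u <= f C.
  move=> uN; apply: le_trans (cmax [ffun i => Ordinal (uN i)] isT).
  rewrite le_eqVlt; apply/orP; left; apply/eqP; rewrite /f; congr (U _ _).
  by apply/funext => i; rewrite ffunE.
have := @spread (fun i => c i) (f c) (f C) N1 (fun i => ltn_ord _) cC
  (lexx _) HY N (leqnn _) v vN _.
rewrite subnn muln0 => S.
have {}S : U 0%N v <= f c + N%:R * r ^+ m * (f C - f c).
  by apply: S => i; have := vN i; have := ltn_ord (c i); lia.
have N0 : 0 <= (N ^ n)%:R :> R by [].
apply: (le_trans (ler_wpM2l N0 S)).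
have -> : \sum_(w : {ffun 'I_n -> 'I_N}) U (m * N)%N (fun i => w i) =
   \sum_w (f w - f c) + (N ^ n)%:R * f c.
  rewrite sumrB sumr_const card_ffun !card_ord mulr_natl subrK.
  by apply: eq_bigr.
rewrite (bigD1 C)//= mulrDr mulrA mulrA -natrM -expnSr.
have : (N ^ n.+1)%:R * r ^+ m * (f C - f c) <= f C - f c.
  by rewrite ler_piMl// subr_ge0.
have : 0 <= \sum_(i | i != C) (f i - f c).
  by apply: sumr_ge0 => i _; rewrite subr_ge0; exact: cmin.
by lra.
Qed.

End mixing.

(** * Choice of the scales *)

Section scales.
Variable R : realType.
Implicit Types x y p e eta : R.

Lemma bernoulli x (i : nat) : 0 <= x -> 1 + i%:R * x <= (1 + x) ^+ i.
Proof.
move=> x0; elim: i => [|i IH]; first by rewrite mul0r addr0 expr0.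
have x1 : 0 <= 1 + x by lra.
apply: le_trans (_ : (1 + x) * (1 + i%:R * x) <= _).
  have : 0 <= i%:R * x * x by rewrite !mulr_ge0.
  by rewrite -natr1; lra.
by rewrite exprS ler_wpM2l.
Qed.

(** Bernoulli's inequality for [y^-1] bounds [i%:R * y ^+ i]. The square leaves a spare factor
    [i%:R] after the number of steps, linear in [i], is paid for. *)
Lemma natmul_expr_bound y (i : nat) : 0 < y < 1 ->
  i%:R ^+ 2 * (y ^+ i) ^+ 2 <= (y / (1 - y)) ^+ 2.
Proof.
move=> /andP[y0 y1].
have t0 : 0 < (1 - y) / y by rewrite divr_gt0//; lra.
have := bernoulli i (ltW t0).
rewrite (_ : 1 + (1 - y) / y = y^-1); last by field; nz.
rewrite exprVn => B.
have yi : 0 < y ^+ i by exact: exprn_gt0.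
have : i%:R * ((1 - y) / y) * y ^+ i <= 1.
  rewrite -ler_pdivlMr// mul1r; lra.
move=> H; have : y ^+ i * i%:R <= y / (1 - y).
  rewrite -[leRHS]invf_div -[leRHS]mul1r ler_pdivlMr//.
  by rewrite mulrC [_ * i%:R]mulrC mulrCA mulrA.
rewrite -exprMn [_ * i%:R]mulrC => H2.
rewrite ler_sqr ?nnegrE//; first by apply: mulr_ge0 => //; exact: ltW.
by apply: divr_ge0; lra.
Qed.

Lemma exists_small_edge p e eta : 1 < p -> 0 < e -> 0 < eta ->
  exists m : nat, (e / m.+1%:R) `^ p <= eta.
Proof.
move=> p1 e0 eta0.
have q0 : 0 < eta `^ p^-1 by exact: powR_gt0.
have pN0 : p != 0 by nz.
have E : eta = (eta `^ p^-1) `^ p by rewrite -powRrM mulVf ?powRr1// ltW.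
exists (Num.truncn (e / eta `^ p^-1)); rewrite [leRHS]E.
apply: ge0_ler_powR; rewrite ?nnegrE; [lra|by rewrite divr_ge0 ?ltW|exact: ltW|].
rewrite ler_pdivrMr// mulrC -ler_pdivrMr//.
exact/ltW/truncnS_gt.
Qed.

(* The only essential use of [p > 1]: crossing a unit cube takes [N] moves, each made of
   [m = O(log N)] steps of duration about [N `^ - p]. *)
Lemma exists_scales (n : nat) p eta : 1 < p -> 0 < eta ->
  exists N m : nat, [/\ (1 < N)%N,
    (N ^ n.+1)%:R * (1 - (2 ^ n)%:R^-1) ^+ m <= 1 :> R &
    (m * N + 1)%:R * (2 / N%:R) `^ p <= eta].
Proof.
move=> p1 eta0; set r : R := 1 - _.
have r0 : 0 <= r.
  by rewrite subr_ge0 invf_le1 ?ltr0n ?expn_gt0// ler1n expn_gt0.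
have r1 : r < 1 by rewrite ltrBlDr ltrDl invr_gt0 ltr0n expn_gt0.
(* Enough steps to halve the unabsorbed fraction. *)
have [j jr] : exists j : nat, r ^+ j.+1 <= 1 / 2.
  have [->|rn0] := eqVneq r 0; first by exists 0%N; rewrite expr1; lra.
  have {}rn0 : 0 < r by rewrite lt0r rn0.
  set t := (1 - r) / r; have t0 : 0 < t by rewrite divr_gt0//; lra.
  exists (Num.truncn t^-1); set i := _.+1.
  have := bernoulli i (ltW t0).
  rewrite (_ : 1 + t = r^-1); last by rewrite /t; field; nz.
  have it : 1 <= i%:R * t.
    by rewrite -ler_pdivrMr// mul1r; exact/ltW/truncnS_gt.
  rewrite exprVn => B; have ri : 0 < r ^+ i by exact: exprn_gt0.
  have : 2 <= (r ^+ i)^-1 by lra.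
  by rewrite -[leLHS]invrK lef_pV2 ?posrE ?invr_gt0//; lra.
(* [y * y] is 2 to the power [1 - p], so [y ^+ i * y ^+ i] is [N] to the power [1 - p] for
   [N = 2 ^ i]. *)
set y : R := 2 `^ ((1 - p) / 2).
have y0 : 0 < y by exact: powR_gt0.
have y1 : y < 1.
  have q0 : 0 < (p - 1) / 2 by lra.
  have E : (1 : R) `^ ((p - 1) / 2) = 1 by rewrite powR1.
  rewrite /y (_ : (1 - p) / 2 = - ((p - 1) / 2)); last by field.
  rewrite powRN invf_lt1 ?powR_gt0// -[ltLHS]E.
  by apply: gt0_ltr_powR; rewrite ?nnegrE// ltr1n.
(* The leading factor 2 absorbs the extra 1 in [m * N + 1]. *)
set c : R := 2 * 2 `^ p * (j.+1 * n.+1)%:R.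
have c0 : 0 < c by rewrite mulr_gt0 ?mulr_gt0 ?powR_gt0// ltr0n.
set Y := (y / (1 - y)) ^+ 2.
pose i := (Num.truncn (c * Y / eta)).+1.
have iY : c * Y / eta < i%:R by exact: truncnS_gt.
have i0 : 0 < i%:R :> R by rewrite ltr0n.
have yN : y ^+ i * y ^+ i = (2 ^ i)%:R * ((2 ^ i)%:R^-1) `^ p.
  have N0 : 0 < (2 ^ i)%:R :> R by rewrite ltr0n expn_gt0.
  have yy : y * y = 2 * 2^-1 `^ p.
    have -> : (2^-1 : R) `^ p = 2 `^ (- p).
      by rewrite -[2^-1]powR_inv1// -powRrM mulN1r.
    rewrite -[X in _ = X * _](@powRr1 _ 2)// -!powRD ?pnatr_eq0 ?implybT//.
    by congr (_ `^ _); field.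
  rewrite -exprMn yy exprMn natrX -exprVn; congr (_ * _).
  rewrite -powR_mulrn ?powR_ge0// -powRrM mulrC powRrM powR_mulrn//.
(* [n.+1 * i] halvings offset the [n.+1 * i] factors 2 of [N ^ n.+1]. *)
exists (2 ^ i)%N, (j.+1 * n.+1 * i)%N; split.
- by rewrite -[1%N](expn0 2) ltn_exp2l.
- rewrite -!mulnA exprM natrX natrX -exprM [(i * n.+1)%N]mulnC.
  rewrite -exprMn exprn_ile1 ?mulr_ge0 ?exprn_ge0//.
  by rewrite mulrC -ler_pdivlMr//; lra.
- rewrite powRM ?invr_ge0//.
  set N := (2 ^ i)%:R; set m := (_ * i)%N.
  have mN : (1 <= m * 2 ^ i)%N by rewrite muln_gt0 expn_gt0 /m !muln_gt0.
  apply: (@le_trans _ _ ((2 * (m * 2 ^ i))%:R * (2 `^ p * N^-1 `^ p))).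
    rewrite ler_wpM2r ?mulr_ge0 ?powR_ge0// ler_nat.
    by rewrite mulSn mul1n addnC leq_add2r.
  rewrite 2!natrM -/N /m natrM.
  have E (a b u v w : R) : 2 * (a * b * u) * (v * w) = 2 * v * a * (b * (u * w)).
    by ring.
  rewrite E -/c -yN -expr2.
  have B : i%:R ^+ 2 * (y ^+ i) ^+ 2 <= Y.
    by apply: natmul_expr_bound; rewrite y0.
  have {}B : c * (i%:R * (y ^+ i) ^+ 2) * i%:R <= c * Y.
    by rewrite -mulrA ler_pM2l// mulrAC -expr2.
  rewrite -(ler_pM2r i0); apply: le_trans B _.
  by rewrite -ler_pdivrMl// [leLHS]mulrC ltW.
Qed.

End scales.

(** * Averages over space-time cylinders *)

Section forward_means.
Variables (R : realType) (n : nat) (p gamma : R).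
Implicit Types (z : 'rV[R]_n) (e a b c d M : R) (m : nat).

(* [F z e a b] stands for the integral over Q x [a, b), where Q is the cube with
   lower corner [z] and edge length [e]. *)
Implicit Type F : 'rV[R]_n -> R -> R -> R -> R.

Definition mean F z e a b : R := F z e a b / (e ^+ n * (b - a)).

(** For a rectangle of edge [e], [window e] is the common duration of the lower and upper parts, and
    [lag e] the time between their starts. *)
Definition window e : R := (1 - gamma) * e `^ p.
Definition lag e : R := (1 + gamma) * e `^ p.

Definition cell z e (v : 'I_n -> nat) : 'rV[R]_n :=
  z + e *: \row_i (v i)%:R.

Definition cube_additive F := forall z e a b m, 0 < e -> a <= b ->
  F z (m.+1%:R * e) a b =
  \sum_(j : {ffun 'I_n -> 'I_m.+1}) F (cell z e (fun i => j i)) e a b.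

Definition forward_bound F M := forall z z' e e' a a' b', 0 < e -> 0 < e' ->
  (forall i, z ord0 i <= z' ord0 i /\ z' ord0 i + e' <= z ord0 i + e) ->
  a <= a' -> a' <= b' -> b' <= a + window e ->
  F z' e' a' b' <= e' ^+ n * (b' - a') *
    mean F z e (a + lag e) (a + lag e + window e) + M * (e ^+ n * window e).

(** All that transport uses of the integral of [f]; parabolic rescaling preserves it with the same
    [M]. *)
Record forward_means F M : Prop := ForwardMeans {
  fm_time : forall z e, interval_additive (F z e);
  fm_cube : cube_additive F;
  fm_step : forward_bound F M }.

Hypotheses (p_gt1 : 1 < p) (gamma01 : 0 < gamma < 1).

Lemma window_gt0 e : 0 < e -> 0 < window e.
Proof.
move: gamma01 => /andP[g0 g1] e0.
by rewrite /window mulr_gt0 ?powR_gt0// subr_gt0.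
Qed.

Lemma lag_gt0 e : 0 < e -> 0 < lag e.
Proof.
move: gamma01 => /andP[g0 g1] e0.
by rewrite /lag mulr_gt0 ?powR_gt0//; lra.
Qed.

(** The small cubes of a tiling step simultaneously; their volumes add up to that of the big cube,
    so the error per unit of spatial volume is that of a single small cube. *)
Lemma cube_step F M z e m : forward_means F M -> 0 < e ->
  forward_step (fun a b => F z e a b / e ^+ n) M
    (window (e / m.+1%:R)) (lag (e / m.+1%:R)).
Proof.
move=> FM e0 a a' b' aa ab bh.
set s := e / m.+1%:R in bh *; have s0 : 0 < s by rewrite divr_gt0.
have h0 := window_gt0 s0.
have eE : e = m.+1%:R * s by rewrite /s mulrC divfK// pnatr_eq0.
clearbody s; have sn : 0 < s ^+ n by rewrite exprn_gt0.
have en : 0 < e ^+ n by rewrite exprn_gt0.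
rewrite ler_pdivrMr// eE (fm_cube FM)// (fm_cube FM)//; last by lra.
rewrite -eE.
set W := \sum_(j : {ffun _}) F _ _ (a + _) _.
apply: (@le_trans _ _ (\sum_(j : {ffun 'I_n -> 'I_m.+1})
   ((b' - a') / window s * F (cell z s (fun i => j i)) s (a + lag s) (a + lag s + window s)
     + M * (s ^+ n * window s)))).
  apply: ler_sum => j _.
  have := fm_step FM s0 s0 (fun i => conj (lexx (cell z s (fun i => j i) ord0 i)) (lexx _))
    aa ab bh.
  move=> H; apply: (le_trans H); rewrite lerD2r.
  rewrite /mean (_ : a + lag s + window s - (a + lag s) = window s); last by ring.
  by rewrite le_eqVlt; apply/orP; left; apply/eqP; field; repeat (apply/andP; split); nz.
rewrite big_split/= -mulr_sumr -/W sumr_const card_ffun !card_ord.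
rewrite le_eqVlt; apply/orP; left; apply/eqP.
have -> : (M * (s ^+ n * window s)) *+ (m.+1 ^ n) = M * window s * e ^+ n.
  rewrite -mulr_natr natrX eE exprMn.
  by move: (window s) => hs; rewrite -!mulrA; congr (_ * _); rewrite mulrC -mulrA.
by field; repeat (apply/andP; split); nz.
Qed.

Lemma mean_time_transport e delta Delta : 0 < e -> 0 < delta -> 0 <= Delta ->
  exists2 C : R, 0 <= C & forall F M z a b c d, 0 <= M -> forward_means F M ->
    delta <= b - a -> delta <= d - c -> delta <= c - b -> d - a <= Delta ->
    mean F z e a b <= mean F z e c d + C * M.
Proof.
move: p_gt1 gamma01 => p1 /andP[g0 g1] e0 de0 De0.
(* Small enough for [2 * h1 + t0 + t1 <= delta] below. *)
have eta0 : 0 < delta / 10 by lra.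
have [m1 m1P] := exists_small_edge p1 e0 eta0.
set e1 := e / m1.+1%:R in m1P.
have e10 : 0 < e1 by rewrite divr_gt0.
have h10 := window_gt0 e10.
(* [window e' + lag e'] is twice the [p]-th power of [e'], hence the nesting condition [s01]. *)
have [m0 m0P] := @exists_small_edge _ p e (window e1 / 2) p1 e0 (ltac:(lra)).
set e' := e / m0.+1%:R in m0P.
have e'0 : 0 < e' by rewrite divr_gt0.
have h00 := window_gt0 e'0.
have t00 := lag_gt0 e'0; have t10 := lag_gt0 e10.
have s01 : window e' + lag e' <= window e1 by rewrite {1}/window /lag; lra.
have pw : 0 < e1 `^ p by exact: powR_gt0.
have pw' : 0 < e' `^ p by exact: powR_gt0.
have ht : window e1 <= delta / 10.
  by rewrite /window; apply: le_trans m1P; rewrite ler_piMl//; lra.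
have st : lag e1 <= 2 * (delta / 10).
  apply: (@le_trans _ _ (2 * e1 `^ p)); last by lra.
  by rewrite /lag ler_pM2r//; lra.
set h1 := window e1 in h10 s01 ht *; set h0 := window e' in h00 s01 *.
set t1 := lag e1 in t10 st *; set t0 := lag e' in t00 s01 *.
(* Enough short windows to cover a long window and any source, whose length is at most [Delta]. *)
have [r rP] : exists r : nat, Num.max h1 Delta <= r%:R * h0.
  exists (Num.truncn (Num.max h1 Delta / h0)).+1.
  by rewrite -ler_pdivrMr// ltW// truncnS_gt.
move: rP; rewrite ge_max => /andP[rh rD].
exists (2 * r%:R * (Delta / t0 * h0 + h1 + h0) / delta).
  have A : 0 <= Delta / t0 * h0.
    by apply: mulr_ge0; [apply: divr_ge0; [exact: De0|exact: ltW]|exact: ltW].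
  by apply: divr_ge0; [apply: mulr_ge0; [exact: mulr_ge0|lra]|lra].
move=> F M z a b c d M0 FM ba dc cb da.
have gD : interval_additive (fun a b => F z e a b / e ^+ n).
  by move=> x y w xy yw; rewrite (fm_time FM _ _ xy yw) mulrDl.
have := @interval_transport R _ M M0 gD h0 t0 h1 t1 Delta h00 t00 h10 s01
  (@cube_step F M z e m0 FM e0) (@cube_step F M z e m1 FM e0) r a b c d delta De0 (ltW t10)
  de0 ba dc da rh (ltac:(lra)) (ltac:(lra)) (ltac:(lra)).
by rewrite /mean !invfM !mulrA.
Qed.

End forward_means.

(** * Passage from early cells to the whole late part *)

Section chaining.
Variables (R : realType) (n : nat) (p gamma : R).
Implicit Types (z : 'rV[R]_n) (e a b c d M : R) (m : nat).
Implicit Type F : 'rV[R]_n -> R -> R -> R -> R.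

Local Notation win := (window p gamma).
Local Notation lg := (lag p gamma).

Lemma cell_cell z e (v w : 'I_n -> nat) :
  cell (cell z e v) e w = cell z e (fun i => v i + w i)%N.
Proof. by apply/rowP => i; rewrite !mxE natrD; ring. Qed.

Lemma cube_mean F z e m a b : cube_additive F -> 0 < e -> a <= b ->
  (m.+1 ^ n)%:R * mean F z (m.+1%:R * e) a b =
  \sum_(j : {ffun 'I_n -> 'I_m.+1}) mean F (cell z e (fun i => j i)) e a b.
Proof.
move=> FA e0 ab; rewrite /mean FA// -mulr_suml natrX exprMn -[in LHS]mulrA.
rewrite [in LHS]invfM mulrCA mulVKf// expf_neq0// pnatr_eq0.
Qed.

(** One step of the rectangle of edge [2 * e], started from a single cell; [2 ^ n] is the ratio of
    volumes. *)
Lemma block_step F M z e (l : 'I_n -> nat) a : 0 < gamma < 1 ->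
  forward_means p gamma F M -> 0 < e -> (forall i, (l i <= 1)%N) ->
  mean F (cell z e l) e a (a + win (2 * e)) <=
  mean F z (2 * e) (a + lg (2 * e)) (a + lg (2 * e) + win (2 * e))
  + (2 ^ n)%:R * M.
Proof.
move=> g01 FM e0 l1; have e20 : 0 < 2 * e by rewrite mulr_gt0.
have h0 := @window_gt0 _ p _ g01 _ e20.
have en : 0 < e ^+ n by rewrite exprn_gt0.
have sub i : z ord0 i <= cell z e l ord0 i /\
    cell z e l ord0 i + e <= z ord0 i + 2 * e.
  rewrite !mxE; have := l1 i; case: (l i) => [|[|]]// _; split; lra.
have ah : a <= a + win (2 * e) by lra.
have H := fm_step FM e20 e0 sub (lexx a) ah (lexx _).
rewrite {1}/mean (_ : a + win (2 * e) - a = win (2 * e)); last by ring.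
rewrite (_ : a + win (2 * e) - a = win (2 * e)) in H; last by ring.
have eh : 0 < e ^+ n * win (2 * e) by exact: mulr_gt0.
rewrite ler_pdivrMr//; apply: (le_trans H).
set x := mean _ _ _ _ _; move: (win (2 * e)) x => y x; rewrite natrX exprMn.
by move: (e ^+ n) (2 ^+ n) => u v; rewrite le_eqVlt; apply/orP; left; apply/eqP; ring.
Qed.

Lemma early_mean_le_late (alpha : R) : 1 < p -> 0 < gamma < 1 -> 0 < alpha < 1 ->
  exists N : nat, 2 * (N.+1%:R^-1 : R) `^ p <= alpha / 4 /\
  exists2 C : R, 0 <= C & forall F M z (v : 'I_n -> nat) a,
    0 <= M -> forward_means p gamma F M -> (forall i, (v i < N.+1)%N) ->
    -1 <= a -> a + win N.+1%:R^-1 <= - (3 / 4 * alpha) ->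
    mean F (cell z N.+1%:R^-1 v) N.+1%:R^-1 a (a + win N.+1%:R^-1) <=
    mean F z 1 alpha 1 + C * M.
Proof.
move=> p1 g01 /andP[a0 a1]; have /andP[g0 g1] := g01.
(* A lag is at most twice the [p]-th power of [e1], so with the budget [alpha / 8] the mixing that
   starts at [- (alpha / 2)] ends by [- (alpha / 4)]. *)
have [N [m [N1 mix mN]]] := @exists_scales R n p (alpha / 8) p1 (ltac:(lra)).
case: N N1 mix mN => // N N1 mix mN; exists N.
set e0 : R := N.+1%:R^-1; set e1 := 2 * e0.
have e00 : 0 < e0 by rewrite invr_gt0.
have e10 : 0 < e1 by rewrite mulr_gt0.
rewrite -/e0 -/e1 in mN.
have P0 : 0 < e1 `^ p by exact: powR_gt0.
have mN0 : 0 <= (m * N.+1)%:R * e1 `^ p by rewrite mulr_ge0// ltW.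
move: mN; rewrite natrD mulrDl mul1r => mN.
have e01 : e0 `^ p <= e1 `^ p.
  by apply: ge0_ler_powR; rewrite ?nnegrE /e1; lra.
split; first by lra.
set K := (m * N.+1)%N in mN mN0.
have h0 := @window_gt0 _ p _ g01 _ e00.
have h1 := @window_gt0 _ p _ g01 _ e10.
have t1 := @lag_gt0 _ p _ g01 _ e10.
have ht : lg e1 - win e1 = 2 * gamma * e1 `^ p by rewrite /lag /window; ring.
have th0 : 0 < 2 * gamma * e1 `^ p by rewrite !mulr_gt0.
have hP : win e1 <= e1 `^ p by rewrite /window ler_piMl//; lra.
have Kt : K%:R * lg e1 <= 2 * (K%:R * e1 `^ p).
  rewrite [leRHS]mulrCA ler_wpM2l// /lag ler_pM2r//; lra.
have Kt0 : 0 <= K%:R * lg e1 by rewrite mulr_ge0// ltW.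
set h := win e1 in h1 ht hP *; set t := lg e1 in t1 ht Kt Kt0 *.
set h' := win e0 in h0 *.
pose s := - (alpha / 2).
(* A common lower bound for the lengths and gaps in the three transports in time; [t - h], the gap
   between consecutive windows, is positive since [gamma > 0]. *)
pose del := Num.min (Num.min h h') (Num.min (t - h) (Num.min (1 - alpha) (alpha / 4))).
have del0 : 0 < del by rewrite /del !lt_min; repeat (apply/andP; split); lra.
have : del <= del by [].
rewrite {2}/del !le_min => /andP[/andP[d1 d2] /andP[d3 /andP[d4 d5]]].
(* In order: reaching the start [s] inside the cell, waiting in a cell during one step, and the
   final passage over the unit cube. *)
have [C0 C00 H0] := @mean_time_transport R n p gamma p1 g01 e0 del 2 e00 del0 (ltac:(lra)).
have [C1 C10 H1] := @mean_time_transport R n p gamma p1 g01 e0 del (t + h) e00 del0 (ltac:(lra)).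
have [C2 C20 H2] := @mean_time_transport R n p gamma p1 g01 1 del 2 ltr01 del0 (ltac:(lra)).
exists (C0 + K%:R * (C1 + (2 ^ n)%:R) + C2).
  by rewrite !addr_ge0// mulr_ge0// addr_ge0.
move=> F M z v a M0 FM vN ge1 ah.
apply: (le_trans (H0 F M _ a (a + h') s (s + h) M0 FM _ _ _ _)); try (rewrite /s; lra).
set kap := (C1 + (2 ^ n)%:R) * M.
(* The added [k%:R * kap] absorbs the cost of the steps, so that [hold] and [block] carry no error
   term. *)
pose U k w := mean F (cell z e0 w) e0 (s + k%:R * t) (s + k%:R * t + h) + k%:R * kap.
have CM : 0 <= C1 * M by rewrite mulr_ge0.
have TM : 0 <= (2 ^ n)%:R * M by rewrite mulr_ge0.
have hold k w : (forall i, (w i < N.+1)%N) -> U k w <= U k.+1 w.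
  move=> _; rewrite /U -natr1.
  have := H1 F M (cell z e0 w) (s + k%:R * t) (s + k%:R * t + h)
    (s + (k%:R + 1) * t) (s + (k%:R + 1) * t + h) M0 FM (ltac:(lra)) (ltac:(lra))
    (ltac:(lra)) (ltac:(lra)).
  by rewrite /kap; lra.
have block k u (j : {ffun 'I_n -> 'I_2}) : (forall i, ((u i).+1 < N.+1)%N) ->
    U k (fun i => u i + j i)%N <=
    (2 ^ n)%:R^-1 * \sum_(l : {ffun 'I_n -> 'I_2}) U k.+1 (fun i => u i + l i)%N.
  move=> _; rewrite /U big_split/= sumr_const card_ffun !card_ord.
  rewrite (eq_bigr (fun l : {ffun 'I_n -> 'I_2} => mean F (cell (cell z e0 u) e0 (fun i => l i)) e0
     (s + k.+1%:R * t) (s + k.+1%:R * t + h))); last by move=> l _; rewrite cell_cell.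
  rewrite -(cube_mean _ _ (fm_cube FM))//; last by lra.
  rewrite mulrDr -[(_ * kap) *+ _]mulr_natl !mulKf ?pnatr_eq0 ?expn_eq0//.
  rewrite -cell_cell -/e1 -[k.+1%:R]natr1.
  have := @block_step F M (cell z e0 u) e0 (fun i => j i) (s + k%:R * t) g01 FM e00
    (fun i => ltn_ord (j i)).
  rewrite -/e1 -/h -/t (_ : s + k%:R * t + t = s + (k%:R + 1) * t); last by ring.
  by rewrite /kap; lra.
have N0 : 0 < (N.+1 ^ n)%:R :> R by rewrite ltr0n expn_gt0.
have := @mixing R n N.+1 m U hold block v N1 vN mix.
rewrite -/K /U big_split/= sumr_const card_ffun !card_ord.
rewrite -(cube_mean _ _ (fm_cube FM))//; last by lra.
rewrite mulfV ?pnatr_eq0// -[(_ * kap) *+ _]mulr_natl -mulrDr ler_pM2l//.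
rewrite !mul0r !addr0 => Hmix.
have H := H2 F M z (s + K%:R * t) (s + K%:R * t + h) alpha 1 M0 FM (ltac:(lra))
  (ltac:(lra)) (ltac:(rewrite /s; lra)) (ltac:(rewrite /s; lra)).
move: Hmix H; rewrite /kap; lra.
Qed.


End chaining.

(** * Positive parts over the early part *)

Section positive_parts.
Variables (R : realType) (n : nat) (p gamma : R).
Implicit Types (z : 'rV[R]_n) (e a b c d M : R) (m : nat).
Implicit Type F : 'rV[R]_n -> R -> R -> R -> R.

Local Notation win := (window p gamma).
Local Notation lg := (lag p gamma).

(** [G] stands for the integral of [[f - c]_+] with [c] the late mean of [F]. The early part is cut
    into cells and slices of duration [win e], and [early_mean_le_late] controls the upper mean of
    each. *)
Lemma positive_part_bound (alpha : R) : 1 < p -> 0 < gamma < 1 -> 0 < alpha < 1 ->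
  exists2 C : R, 0 <= C & forall F G M z, 0 <= M ->
    forward_means p gamma F M ->
    (forall y e, interval_additive (G y e)) -> cube_additive G ->
    (forall y e a b, a <= b -> 0 <= G y e a b) ->
    (forall y e a, 0 < e -> G y e a (a + win e) <= e ^+ n * win e *
      (M + Num.max 0 (mean F y e (a + lg e) (a + lg e + win e)
                      - mean F z 1 alpha 1))) ->
    G z 1 (-1) (- alpha) <= C * M.
Proof.
move=> p1 g01 a01; have /andP[g0 g1] := g01; have /andP[a0 a1] := a01.
have [N [eN [C C0 HC]]] := @early_mean_le_late R n p gamma alpha p1 g01 a01.
set e := N.+1%:R^-1 in eN HC; have e0 : 0 < e by rewrite invr_gt0.
have h0 := @window_gt0 _ p _ g01 _ e0.
have t0 := @lag_gt0 _ p _ g01 _ e0.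
have ht : win e + lg e = 2 * e `^ p by rewrite /window /lag; ring.
pose B := e ^+ n * win e * (1 + C).
have B0 : 0 <= B by rewrite !mulr_ge0 ?exprn_ge0//; lra.
pose r := (Num.truncn ((win e)^-1)).+1.
have rh : 1 <= r%:R * win e.
  by have := truncnS_gt (win e)^-1; rewrite -/r -[ltLHS]mul1r ltr_pdivrMr// => /ltW.
exists ((N.+1 ^ n)%:R * (r%:R * B)).
  by apply: mulr_ge0 => //; apply: mulr_ge0.
move=> F G M z M0 FM GD GC Gp Gs.
(* A slice may start as late as [- alpha]: its upper window still ends by [- (3 / 4 * alpha)], as
   [win e + lg e <= alpha / 4]. *)
have piece (v : 'I_n -> nat) a : (forall i, (v i < N.+1)%N) -> -1 <= a -> a <= - alpha ->
    G (cell z e v) e a (a + win e) <= B * M.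
  move=> vN ge1 al; apply: (le_trans (Gs _ _ _ e0)).
  rewrite /B -[leRHS]mulrA; apply: ler_wpM2l.
    by apply: mulr_ge0; [apply: exprn_ge0|]; exact: ltW.
  rewrite mulrDl mul1r lerD2l ge_max mulr_ge0//= lerBlDl.
  by apply: HC => //; lra.
have chain (v : 'I_n -> nat) (k : nat) a : (forall i, (v i < N.+1)%N) -> -1 <= a -> a <= - alpha ->
    - alpha <= a + k%:R * win e -> G (cell z e v) e a (- alpha) <= k%:R * (B * M).
  move=> vN; elim: k a => [|k IH] a ge1 al ak.
    have -> : a = - alpha by lra.
    by have := GD (cell z e v) e _ _ _ (lexx (- alpha)) (lexx (- alpha)); lra.
  have BM : 0 <= k%:R * (B * M) by apply: mulr_ge0 => //; exact: mulr_ge0.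
  have P := piece v a vN ge1 al.
  have [ah|ah] := leP (a + win e) (- alpha).
    rewrite (GD _ _ _ _ _ (_ : a <= a + win e) ah); last lra.
    have := IH (a + win e) (ltac:(lra)) ah (ltac:(move: ak; rewrite -natr1; lra)).
    by rewrite -natr1; lra.
  (* The last slice overshoots [- alpha], harmlessly because [G] is nonnegative. *)
  have := GD (cell z e v) e _ _ _ al (ltW ah).
  have := Gp (cell z e v) e _ _ (ltW ah).
  by rewrite -natr1; lra.
have -> : G z 1 (-1) (- alpha) =
    \sum_(j : {ffun 'I_n -> 'I_N.+1}) G (cell z e (fun i => j i)) e (-1) (- alpha).
  by rewrite -GC//; [rewrite mulfV ?pnatr_eq0|lra].
apply: (@le_trans _ _ (\sum_(j : {ffun 'I_n -> 'I_N.+1}) r%:R * (B * M))).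
  apply: ler_sum => j _; apply: chain => //; lra.
by rewrite sumr_const card_ffun !card_ord -[leLHS]mulr_natl !mulrA.
Qed.

End positive_parts.

(** * Integrals over cylinders *)

Section cylinder_integrals.
Variables (R : realType) (n : nat).
Implicit Types (z : 'rV[R]_n) (e a b c : R) (g f : spacetime R n -> R).

Local Notation mu := (@lebesgue R n).

Definition cylinder z e a b : set (lebesgue_space R n) :=
  box (z, a) (\row_i (z ord0 i + e), b).

Lemma in_cylinder z e a b (w : spacetime R n) : cylinder z e a b w <->
  (forall i, z ord0 i <= w.1 ord0 i < z ord0 i + e) /\ a <= w.2 < b.
Proof.
split=> [[H1 H2]|[H1 H2]]; split => // i.
  by have := H1 i; rewrite /= mxE.
by rewrite /= mxE; exact: H1.
Qed.

Lemma measurable_cylinder z e a b : measurable (cylinder z e a b).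
Proof. exact: measurable_box. Qed.

Lemma lebesgue_cylinder z e a b : 0 <= e -> a <= b ->
  mu (cylinder z e a b) = (e ^+ n * (b - a))%:E.
Proof.
move=> e0 ab; rewrite /lebesgue /cylinder lebesgue_outer_box /volume/=.
rewrite (max_idPr _) ?subr_ge0//; congr (_ * _)%:E.
rewrite (eq_bigr (fun=> e)) ?prodr_const ?card_ord// => i _.
by rewrite mxE addrC addKr (max_idPr _).
Qed.

Definition box_integrable g :=
  forall a b : spacetime R n, mu.-integrable (box a b) (EFin \o g).

Lemma L1loc_box_integrable f : L1loc f -> box_integrable f.
Proof.
move=> [mf If] a b; pose K := [set z : spacetime R n |
  (forall i, a.1 ord0 i <= z.1 ord0 i <= b.1 ord0 i) /\ a.2 <= z.2 <= b.2].
have mK : measurable (K : set (lebesgue_space R n)) by exact: measurable_closed_box.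
have cK : compact K.
  have -> : K = [set v : 'rV[R]_n | forall i, `[a.1 ord0 i, b.1 ord0 i]%classic (v ord0 i)]
      `*` `[a.2, b.2]%classic.
    apply/seteqP; split => z [H1 H2]; split.
    - by move=> i; rewrite set_itvcc; exact: H1.
    - by rewrite set_itvcc.
    - by move=> i; have := H1 i; rewrite set_itvcc.
    - by move: H2; rewrite set_itvcc.
  apply: compact_setX; last exact: segment_compact.
  apply: (@rV_compact _ _ (fun i => `[a.1 ord0 i, b.1 ord0 i]%classic)) => i.
  exact: segment_compact.
have KI : mu.-integrable (K : set (lebesgue_space R n)) (EFin \o f).
  apply/integrableP; split; last exact: If.
  by apply/measurable_EFinP; exact: measurable_funTS.
apply: (@integrableS _ _ _ mu K) => //; first exact: measurable_box.
move=> z [H1 /andP[H2 H3]]; split=> [i|]; last by rewrite H2 ltW.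
by have /andP[h1 h2] := H1 i; rewrite h1 ltW.
Qed.

Definition cyl_int g z e a b : R := \int[mu]_(w in cylinder z e a b) g w.

Lemma cyl_int_additive g z e : box_integrable g -> interval_additive (cyl_int g z e).
Proof.
move=> Ig a b c ab bc; rewrite /cyl_int.
have cU : cylinder z e a c = cylinder z e a b `|` cylinder z e b c.
  apply/seteqP; split => w.
    move=> /in_cylinder[H1 /andP[H2 H3]]; have [wb|bw] := ltP w.2 b.
      by left; apply/in_cylinder; split => //; rewrite H2.
    by right; apply/in_cylinder; split => //; rewrite bw.
  move=> [|] /in_cylinder[H1 /andP[H2 H3]]; apply/in_cylinder; split => //.
    by rewrite H2 (lt_le_trans H3).
  by rewrite (le_trans ab).
rewrite cU Rintegral_setU//; try exact: measurable_cylinder.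
  by rewrite -cU; exact: Ig.
apply/eqP/seteqP; split => // w [] /in_cylinder[_ /andP[_ h1]] /in_cylinder[_ /andP[h2 _]].
by move: (lt_le_trans h1 h2); rewrite ltxx.
Qed.

Lemma cylinder_cells z e a b m : 0 < e ->
  cylinder z (m.+1%:R * e) a b =
  \big[setU/set0]_(j : {ffun 'I_n -> 'I_m.+1}) cylinder (cell z e (fun i => j i)) e a b.
Proof.
move=> e0; rewrite -big_enum/= -bigcup_seq; apply/seteqP; split => [w|w].
  move=> /in_cylinder[H1 H2].
  pose q i := Num.truncn ((w.1 ord0 i - z ord0 i) / e).
  have qP i : (q i)%:R * e <= w.1 ord0 i - z ord0 i < (q i).+1%:R * e.
    have /andP[h1 h2] := H1 i.
    rewrite -ler_pdivlMr// -ltr_pdivrMr//; apply/truncn_itv.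
    by apply: divr_ge0; [rewrite subr_ge0|exact: ltW].
  have qm i : (q i < m.+1)%N.
    have /andP[h1 h2] := H1 i; have /andP[h3 h4] := qP i.
    by rewrite -(ltr_nat R) -(ltr_pM2r e0); lra.
  exists [ffun i => Ordinal (qm i)].
    by rewrite /= mem_enum.
  apply/in_cylinder; split => // i; rewrite !mxE ffunE/=.
  have /andP[h3 h4] := qP i; move: h4; rewrite -natr1 => h4.
  by apply/andP; split; lra.
move=> -[j _] /in_cylinder[H1 H2].
apply/in_cylinder; split => // i; have := H1 i; rewrite !mxE => /andP[h1 h2].
have je : e * (j i)%:R + e <= m.+1%:R * e.
  by rewrite -[X in _ + X]mulr1 -mulrDr natr1 mulrC ler_pM2r// ler_nat.
have j0 : 0 <= e * (j i)%:R by rewrite mulr_ge0// ltW.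
by apply/andP; split; lra.
Qed.

Lemma cyl_int_cube_additive g : box_integrable g -> cube_additive (cyl_int g).
Proof.
move=> Ig z e a b m e0 ab; rewrite /cyl_int /Rintegral.
have mC (j : {ffun 'I_n -> 'I_m.+1}) : measurable (cylinder (cell z e (fun i => j i)) e a b).
  exact: measurable_cylinder.
rewrite cylinder_cells// -big_enum integral_bigsetU_EFin//=.
- rewrite big_enum/= sum_fine//.
  by move=> j _; apply: integrable_fin_num => //; exact: Ig.
- exact: enum_uniq.
- apply/trivIsetP => /= j k _ _; apply: contraNeq.
  move=> /set0P[w [] /in_cylinder[H1 _] /in_cylinder[H2 _]].
  apply/eqP/ffunP => i; apply/val_inj => /=.
  have /andP[a1 a2] := H1 i; have /andP[b1 b2] := H2 i.
  rewrite !mxE in a1 a2 b1 b2.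
  have lt1 (u v : nat) : e * u%:R <= w.1 ord0 i - z ord0 i -> w.1 ord0 i - z ord0 i < e * v%:R + e ->
      (u <= v)%N.
    move=> h1 h2; rewrite -ltnS -(ltr_nat R) -(ltr_pM2l e0) -natr1 mulrDr mulr1.
    exact: le_lt_trans h1 h2.
  by apply/eqP; rewrite eqn_leq !lt1//; lra.
- rewrite big_enum/= -cylinder_cells//.
  exact: (measurable_int mu (Ig _ _)).
Qed.

Lemma box_integrable_cst c : box_integrable (fun=> c).
Proof.
move=> a b; apply/integrableP; split; first exact: measurable_cst.
rewrite (eq_integral (fun=> `|c|%:E))// integral_cst//=; last exact: measurable_box.
by rewrite /lebesgue lebesgue_outer_box -EFinM ltry.
Qed.

Lemma box_integrable_pos f c : box_integrable f ->
  box_integrable (fun w => Num.max (f w - c) 0).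
Proof.
move=> If a b.
have mB := @measurable_box R n a b.
have Ic := @box_integrable_cst c a b.
have I1 : mu.-integrable (box a b) (EFin \o (fun w => f w - c)).
  by have := integrableB mB (If a b) Ic; apply: eq_integrable.
by have := integrable_funepos mB I1; apply: eq_integrable => // w _; rewrite funeposE /= -EFin_max.
Qed.

Lemma cyl_int_ge0 g z e a b : (forall w, 0 <= g w) -> 0 <= cyl_int g z e a b.
Proof. by move=> g0; apply: Rintegral_ge0. Qed.

Lemma cyl_int_sub g z e a b z' e' a' b' : box_integrable g -> (forall w, 0 <= g w) ->
  cylinder z' e' a' b' `<=` cylinder z e a b ->
  cyl_int g z' e' a' b' <= cyl_int g z e a b.
Proof.
move=> Ig g0 sub; apply: fine_le.
- by apply: integrable_fin_num; [exact: measurable_cylinder|exact: Ig].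
- by apply: integrable_fin_num; [exact: measurable_cylinder|exact: Ig].
- apply: ge0_subset_integral => //; try exact: measurable_cylinder.
    exact: (measurable_int mu (Ig _ _)).
  by move=> w _; rewrite lee_fin.
Qed.

Lemma cyl_int_le_cst f g z e a b c : box_integrable f -> box_integrable g ->
  0 <= e -> a <= b -> (forall w, f w <= g w + c) ->
  cyl_int f z e a b <= cyl_int g z e a b + e ^+ n * (b - a) * c.
Proof.
move=> If Ig e0 ab fg.
have mC := measurable_cylinder z e a b.
have Ic : mu.-integrable (cylinder z e a b) (EFin \o (fun=> c)).
  exact: box_integrable_cst.
have -> : e ^+ n * (b - a) * c = \int[mu]_(w in cylinder z e a b) c.
  by rewrite Rintegral_cst//= lebesgue_cylinder//= mulrC.
rewrite /cyl_int -RintegralD//; last exact: Ig.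
apply: le_Rintegral => //; first exact: If.
by have := integrableD mC (Ig _ _) Ic; apply: eq_integrable.
Qed.

End cylinder_integrals.

(** * Parabolic rescaling *)

Section parabolic_scaling.
Variables (R : realType) (n : nat) (p gamma : R) (z0 : 'rV[R]_n) (t L : R).
Implicit Types (z : 'rV[R]_n) (e a b c M : R).
Implicit Type F : 'rV[R]_n -> R -> R -> R -> R.

Local Notation T := (L `^ p).

(** Pullback under a parabolic dilation; division by its Jacobian leaves means unchanged. *)
Definition rescale F z e a b : R :=
  F (z0 + L *: z) (L * e) (t + T * a) (t + T * b) / (L ^+ n * T).

Hypothesis L0 : 0 < L.

Let T0 : 0 < T. Proof. exact: powR_gt0. Qed.

Lemma rescale_mean F z e a b :
  mean (rescale F) z e a b = mean F (z0 + L *: z) (L * e) (t + T * a) (t + T * b).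
Proof.
rewrite /mean /rescale -mulrA -invfM; congr (_ / _).
by rewrite exprMn; ring.
Qed.

Lemma rescale_additive F : (forall z e, interval_additive (F z e)) ->
  forall z e, interval_additive (rescale F z e).
Proof.
move=> FD z e a b c ab bc.
by rewrite /rescale (FD _ _ _ (t + T * b)) ?lerD2l ?ler_pM2l// mulrDl.
Qed.

Lemma rescale_cube_additive F : cube_additive F -> cube_additive (rescale F).
Proof.
move=> FA z e a b m e0 ab; rewrite /rescale mulrCA FA ?mulr_gt0 ?lerD2l ?ler_pM2l//.
rewrite mulr_suml; apply: eq_bigr => j _; congr (F _ _ _ _ / _).
by apply/rowP => i; rewrite !mxE; ring.
Qed.

Lemma window_scale e : 0 <= e -> window p gamma (L * e) = T * window p gamma e.
Proof. by move=> e0; rewrite /window powRM ?(ltW L0)//; ring. Qed.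

Lemma lag_scale e : 0 <= e -> lag p gamma (L * e) = T * lag p gamma e.
Proof. by move=> e0; rewrite /lag powRM ?(ltW L0)//; ring. Qed.

Lemma rescale_forward_means F M :
  forward_means p gamma F M -> forward_means p gamma (rescale F) M.
Proof.
case=> FD FA FB; split; [exact: rescale_additive|exact: rescale_cube_additive|].
move=> z z' e e' a a' b' e0 e'0 sub aa ab bh.
have LT : 0 < L ^+ n * T by rewrite mulr_gt0// exprn_gt0.
rewrite rescale_mean {1}/rescale ler_pdivrMr//.
have Le0 : 0 < L * e by rewrite mulr_gt0.
have Le0' : 0 < L * e' by rewrite mulr_gt0.
have sub' i : (z0 + L *: z) ord0 i <= (z0 + L *: z') ord0 i /\
    (z0 + L *: z') ord0 i + L * e' <= (z0 + L *: z) ord0 i + L * e.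
  have [s1 s2] := sub i; rewrite !mxE -!addrA -!mulrDr !lerD2l !ler_pM2l//.
have := FB (z0 + L *: z) (z0 + L *: z') (L * e) (L * e') (t + T * a) (t + T * a')
  (t + T * b') Le0 Le0' sub'.
rewrite (window_scale (ltW e0)) (lag_scale (ltW e0)) -!addrA -!mulrDr !lerD2l !ler_pM2l//.
rewrite !addrA => /(_ aa ab); rewrite -!addrA => /(_ bh)/le_trans; apply.
rewrite le_eqVlt; apply/orP; left; apply/eqP.
by rewrite !exprMn; ring.
Qed.

End parabolic_scaling.

(** * The norm in terms of cylinders, and its comparison for two parameters *)

Section parabolic_parts.
Variables (R : realType) (n : nat) (p : R).
Implicit Types (x : 'rV[R]_n) (t L gamma M : R) (f : spacetime R n -> R).

Local Notation mu := (@lebesgue R n).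

Definition corner x L : 'rV[R]_n := \row_i (x ord0 i - L / 2).

Lemma cube_cylinder x L a b :
  cube x L `*` [set s | a <= s < b] = cylinder (corner x L) L a b :> set (spacetime R n).
Proof.
have E i : corner x L ord0 i + L = x ord0 i + L / 2 by rewrite mxE; field.
apply/seteqP; split => w.
  by move=> [H1 H2]; apply/in_cylinder; split => // i; rewrite E mxE; exact: H1.
by move=> /in_cylinder[H1 H2]; split => // i; have := H1 i; rewrite E mxE.
Qed.

Lemma lower_partE gamma x t L : lower_part p gamma x t L =
  cylinder (corner x L) L (t - L `^ p) (t - L `^ p + window p gamma L).
Proof.
rewrite -cube_cylinder /lower_part.
by rewrite (_ : _ + window _ _ _ = t - gamma * L `^ p)// /window; ring.
Qed.

Lemma upper_partE gamma x t L : upper_part p gamma x t L =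
  cylinder (corner x L) L (t - L `^ p + lag p gamma L)
    (t - L `^ p + lag p gamma L + window p gamma L).
Proof.
rewrite -cube_cylinder /upper_part.
rewrite (_ : t - _ + lag _ _ _ = t + gamma * L `^ p); last by rewrite /lag; ring.
by rewrite (_ : _ + window _ _ _ = t + L `^ p)// /window; ring.
Qed.

Lemma avg_cylinder f z e a b : 0 <= e -> a <= b ->
  avg f (cylinder z e a b) = mean (cyl_int f) z e a b.
Proof. by move=> e0 ab; rewrite /avg lebesgue_cylinder// mulrC. Qed.

Definition oscillation f gamma z e a : R :=
  cyl_int (fun w => Num.max (f w - mean (cyl_int f) z e
     (a + lag p gamma e) (a + lag p gamma e + window p gamma e)) 0)
    z e a (a + window p gamma e).

Lemma bmo_termE gamma f x t L : 0 < gamma < 1 -> L1loc f -> 0 < L ->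
  ((mu (lower_part p gamma x t L))^-1 *
    \int[mu]_(z in lower_part p gamma x t L)
      (Num.max (f z - avg f (upper_part p gamma x t L)) 0)%:E)%E =
  (oscillation f gamma (corner x L) L (t - L `^ p) /
    (L ^+ n * window p gamma L))%:E.
Proof.
move=> g01 /L1loc_box_integrable If L0.
have h0 := @window_gt0 _ p _ g01 _ L0; have Ln : 0 < L ^+ n by rewrite exprn_gt0.
have Lh : 0 < L ^+ n * window p gamma L by rewrite mulr_gt0.
rewrite lower_partE upper_partE avg_cylinder ?ltW// ?ltrDl//.
rewrite lebesgue_cylinder ?ltW// ?ltrDl//.
rewrite [t - _ + _ - _]addrC addKr inver gt_eqF// EFinM muleC; congr (_ * _)%E.
rewrite /oscillation /cyl_int fineK//.
apply: integrable_fin_num; [exact: measurable_cylinder|].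
exact: box_integrable_pos.
Qed.

Lemma bmo_normE gamma f : 0 < gamma < 1 -> L1loc f ->
  bmo_norm p gamma f = ereal_sup [set k | exists x t L, 0 < L /\
    k = (oscillation f gamma (corner x L) L (t - L `^ p) / (L ^+ n * window p gamma L))%:E].
Proof.
move=> g01 fL; congr ereal_sup; apply/seteqP; split => k /=;
  move=> [x [t [L [L0 ->]]]]; exists x, t, L; split => //.
  exact: bmo_termE.
by rewrite bmo_termE.
Qed.

Lemma oscillation_le gamma f M z e a : 0 < gamma < 1 -> L1loc f ->
  (bmo_norm p gamma f <= M%:E)%E -> 0 < e ->
  oscillation f gamma z e a <= M * (e ^+ n * window p gamma e).
Proof.
move=> g01 fL; rewrite bmo_normE// => B e0.
have h0 := @window_gt0 _ p _ g01 _ e0; have en : 0 < e ^+ n by rewrite exprn_gt0.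
(* Every cylinder of edge [e] and duration [window p gamma e] is the lower part of a rectangle,
   whose center is recovered here. *)
pose x : 'rV[R]_n := \row_i (z ord0 i + e / 2).
have zE : corner x e = z by apply/rowP => i; rewrite !mxE addrK.
have eh : 0 < e ^+ n * window p gamma e by rewrite mulr_gt0.
rewrite -ler_pdivrMr// -lee_fin; apply: le_trans B.
apply: ereal_sup_ubound; exists x, (a + e `^ p), e; split => //.
by rewrite zE addrK.
Qed.

(** [f <= [f - c]_+ + c] with [c] the upper mean; the integral of the positive part is then enlarged
    from the piece to the whole lower part. *)
Lemma cyl_int_forward_means gamma f M : 0 < gamma < 1 -> L1loc f ->
  (bmo_norm p gamma f <= M%:E)%E -> forward_means p gamma (cyl_int f) M.
Proof.
move=> g01 fL B; have If := L1loc_box_integrable fL.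
split; [by move=> *; exact: cyl_int_additive|exact: cyl_int_cube_additive|].
move=> z z' e e' a a' b' e0 e'0 sub aa ab bh.
set c := mean _ _ _ _ _.
have Ig := @box_integrable_pos _ _ f c If.
have := @cyl_int_le_cst _ _ f _ z' e' a' b' c If Ig (ltW e'0) ab.
move=> H; apply: le_trans (H _) _.
  by move=> w; rewrite -lerBlDr le_max lexx.
rewrite addrC lerD2l; apply: le_trans (oscillation_le z a g01 fL B e0).
apply: cyl_int_sub => // [w|w /in_cylinder[H1 /andP[H2 H3]]].
  by rewrite le_max lexx orbT.
apply/in_cylinder; split => [i|].
  have [s1 s2] := sub i; have /andP[h1 h2] := H1 i.
  by rewrite (le_trans s1 h1) (lt_le_trans h2 s2).
by rewrite (le_trans aa H2) (lt_le_trans H3 bh).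
Qed.

(** [[f - c]_+ <= [f - k]_+ + [k - c]_+] with [k] the upper mean; the norm bounds the integral of
    the first term and the second is constant. *)
Lemma cyl_int_pos_le gamma f M c z e a : 0 < gamma < 1 -> L1loc f ->
  (bmo_norm p gamma f <= M%:E)%E -> 0 < e ->
  cyl_int (fun w => Num.max (f w - c) 0) z e a (a + window p gamma e) <=
  e ^+ n * window p gamma e * (M + Num.max 0 (mean (cyl_int f) z e
     (a + lag p gamma e) (a + lag p gamma e + window p gamma e) - c)).
Proof.
move=> g01 fL B e0; have If := L1loc_box_integrable fL.
have h0 := @window_gt0 _ p _ g01 _ e0.
set k := mean _ _ _ _ _.
have := @cyl_int_le_cst _ _ (fun w => Num.max (f w - c) 0) (fun w => Num.max (f w - k) 0)
  z e a (a + window p gamma e) (Num.max 0 (k - c)) (@box_integrable_pos _ _ f c If)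
  (@box_integrable_pos _ _ f k If) (ltW e0) (ltac:(rewrite lerDl; exact: ltW)).
move=> H; apply: le_trans (H _) _.
  move=> w; rewrite !maxEle; do !case: ifPn; rewrite -?ltNge; lra.
rewrite [leRHS]mulrDr; apply: lerD; last first.
  by rewrite (_ : a + window p gamma e - a = window p gamma e)//; ring.
by rewrite mulrC; exact: oscillation_le.
Qed.

Lemma bmo_norm_ge0 gamma f : (0 <= bmo_norm p gamma f)%E.
Proof.
set k := ((mu (lower_part p gamma 0 0 1))^-1 *
         \int[mu]_(z in lower_part p gamma 0 0 1)
           (Num.max (f z - avg f (upper_part p gamma 0 0 1)) 0)%:E)%E.
apply: (@le_trans _ _ k); last first.
  by apply: ereal_sup_ubound; exists 0, 0, 1; split.
rewrite mule_ge0 ?inve_ge0//; apply: integral_ge0 => w _.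
by rewrite lee_fin le_max lexx orbT.
Qed.

Lemma bmo_norm_le (gamma alpha : R) : 1 < p -> 0 < gamma < 1 -> 0 < alpha < 1 ->
  exists2 C : R, 0 < C & forall f, L1loc f ->
    (bmo_norm p alpha f <= C%:E * bmo_norm p gamma f)%E.
Proof.
move=> p1 g01 a01; have /andP[a0 a1] := a01.
have [C C0 HC] := @positive_part_bound R n p gamma alpha p1 g01 a01.
have D0 : 0 <= C / (1 - alpha) by rewrite divr_ge0// subr_ge0 ltW.
have D1 : 0 < C / (1 - alpha) + 1 by lra.
(* Division by [1 - alpha] accounts for the measure of the lower part; the [+ 1] makes the constant
   positive, as the case of an infinite norm requires. *)
exists (C / (1 - alpha) + 1) => //.
move=> f fL; have If := L1loc_box_integrable fL.
have := bmo_norm_ge0 gamma f; have := lexx (bmo_norm p gamma f).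
case: {2 3 4}(bmo_norm p gamma f) => [M| |//]; last first.
  by move=> _ _; rewrite gt0_muley ?lte_fin//; exact: leey.
rewrite lee_fin => B M0; rewrite bmo_normE//.
apply: ub_ereal_sup => _ [x [t [L [L0 ->]]]]; rewrite -EFinM lee_fin.
have T0 : 0 < L `^ p by exact: powR_gt0.
have Ln : 0 < L ^+ n by rewrite exprn_gt0.
have h0 := @window_gt0 _ p _ a01 _ L0.
have Lh : 0 < L ^+ n * window p alpha L by rewrite mulr_gt0.
rewrite ler_pdivrMr//.
pose z := corner x L.
(* In these coordinates the lower and upper parts are the unit cube times [[-1, - alpha)] and times
   [[alpha, 1)]. *)
pose F := rescale p z t L (cyl_int f); pose c := mean F 0 1 alpha 1.
pose g w := Num.max (f w - c) 0.
have Ig : box_integrable g by exact: box_integrable_pos.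
have LT : 0 < L ^+ n * L `^ p by rewrite mulr_gt0.
have FM : forward_means p gamma F M.
  by apply: rescale_forward_means => //; exact: cyl_int_forward_means.
have := HC F (rescale p z t L (cyl_int g)) M 0 M0 FM.
have G1 y e : interval_additive (rescale p z t L (cyl_int g) y e).
  by apply: rescale_additive => // *; exact: cyl_int_additive.
have G2 : cube_additive (rescale p z t L (cyl_int g)).
  by apply: rescale_cube_additive => //; exact: cyl_int_cube_additive.
have G3 y e a b : a <= b -> 0 <= rescale p z t L (cyl_int g) y e a b.
  move=> _; apply: divr_ge0; last exact: ltW.
  by apply: cyl_int_ge0 => w; rewrite le_max lexx orbT.
have G4 y e a : 0 < e -> rescale p z t L (cyl_int g) y e a (a + window p gamma e) <=
    e ^+ n * window p gamma e * (M + Num.max 0 (mean F y e (a + lag p gamma e)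
      (a + lag p gamma e + window p gamma e) - mean F 0 1 alpha 1)).
  move=> e0; rewrite -/c /F rescale_mean /rescale ler_pdivrMr//.
  have := @cyl_int_pos_le gamma f M c (z + L *: y) (L * e) (t + L `^ p * a) g01 fL B
    (mulr_gt0 L0 e0).
  rewrite (window_scale _ _ L0 (ltW e0)) (lag_scale _ _ L0 (ltW e0)) !mulrDr !addrA => /le_trans; apply.
  rewrite -!mulrDr le_eqVlt; apply/orP; left; apply/eqP.
  by rewrite exprMn; ring.
move=> /(_ G1 G2 G3 G4); rewrite {1}/rescale ler_pdivrMr// scaler0 addr0 mulr1 => H.
have hE : window p alpha L = (1 - alpha) * L `^ p by [].
rewrite /oscillation.
have -> : mean (cyl_int f) (corner x L) L (t - L `^ p + lag p alpha L)
   (t - L `^ p + lag p alpha L + window p alpha L) = c.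
  rewrite /c /F rescale_mean scaler0 addr0 mulr1 -/z /lag hE.
  by congr (mean _ _ _ _ _); ring.
move: H; rewrite -/z -/g (_ : t + L `^ p * -1 = t - L `^ p); last by ring.
rewrite (_ : t + L `^ p * - alpha = t - L `^ p + window p alpha L); last by rewrite hE; ring.
move/le_trans; apply.
have -> : (C / (1 - alpha) + 1) * M * (L ^+ n * window p alpha L) =
   C * M * (L ^+ n * L `^ p) + M * (L ^+ n * window p alpha L).
  by rewrite hE; field; lra.
by rewrite lerDl mulr_ge0// ltW// mulr_gt0.
Qed.

End parabolic_parts.

Theorem corollary3p6 (R : realType) (n : nat) (p gamma alpha : R) :
  (0 < n)%N -> 1 < p -> 0 < gamma < 1 -> 0 < alpha < 1 ->
  BMOplus p gamma = BMOplus p alpha :> set (spacetime R n -> R) /\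
  exists C1 C2 : R, [/\ 0 < C1, 0 < C2 &
    forall f : spacetime R n -> R, L1loc f ->
      (bmo_norm p gamma f <= C1%:E * bmo_norm p alpha f)%E /\
      (bmo_norm p alpha f <= C2%:E * bmo_norm p gamma f)%E].
Proof.
move=> _ p1 g01 a01.
have [C1 C10 H1] := @bmo_norm_le R n p alpha gamma p1 a01 g01.
have [C2 C20 H2] := @bmo_norm_le R n p gamma alpha p1 g01 a01.
split; last by exists C1, C2; split => // f fL; split; [exact: H1|exact: H2].
have fin (C : R) (x y : \bar R) : 0 < C -> (x <= C%:E * y)%E -> (y < +oo)%E ->
    (x < +oo)%E.
  move=> C0 xy yoo; apply: le_lt_trans xy _.
  by apply: lte_mul_pinfty => //; rewrite lee_fin ltW.
apply/seteqP; split => f [fL foo]; (split; first exact: fL).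
  exact: fin C20 (H2 f fL) foo.
exact: fin C10 (H1 f fL) foo.
Qed.
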